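(* (1) Define the functions $f_{20}$ and $f_{21}$ on $(0,1)$ by $$f_{20}(r)=\left(\frac34+\frac14r^2\right)\left(r-(1-r^2)\operatorname{arth} r\right)\mathcal{K}(r)-\left[\mathcal{E}(r)-(1-r^2)\mathcal{K}(r)\right]\operatorname{arth} r,$$ $$f_{21}(r)=\left[\mathcal{E}(r)-(1-r^2)\mathcal{K}(r)\right]\operatorname{arth} r-\left(\frac34+\frac{1}{160}r^2\right)\left(r-(1-r^2)\operatorname{arth} r\right)\mathcal{K}(r).$$ Then $f_{20}$ and $f_{21}$ are both strictly increasing and convex on $(0,1)$, with ranges $(0,\log2)$ and $(0,\infty)$, respectively. (2) The function $$f_{22}(r)=\frac{\left(r-(1-r^2)\operatorname{arth} r\right)\mathcal{E}(r)-2(1-r^2)(\operatorname{arth} r-r)\mathcal{K}(r)}{r^5}$$ is strictly increasing from $(0,1)$ onto $(\pi/30,1)$. (3) The function $$f_{23}(r)=2\,\frac{(1-r^2)\operatorname{arth} r}{r}\,\mathcal{K}(r)+\frac{r-(1-r^2)\operatorname{arth} r}{r^3}\,\mathcal{E}(r)$$ is strictly decreasing from $(0,1)$ onto $(1,4\pi/3)$. (4) The function $$f_{24}(r)=\frac{1}{r^2}\left\{4\,\frac{[\mathcal{E}(r)-(1-r^2)\mathcal{K}(r)]\operatorname{arth} r}{\left(r-(1-r^2)\operatorname{arth} r\right)\mathcal{K}(r)}-3\right\}$$ is strictly increasing from $(0,1)$ onto $(1/40,1)$. In particular, for $r\in(0,1)$, $$\frac34+\frac{r^2}{4}P_4(r)<\frac{[\mathcal{E}(r)-(1-r^2)\mathcal{K}(r)]\operatorname{arth}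 r}{\left(r-(1-r^2)\operatorname{arth} r\right)\mathcal{K}(r)}<\frac34+\frac{r^2}{4},$$ where $$P_4(r)=\max\left\{\frac{1}{40},\ 1-\frac{\log 16}{r\left(r-(1-r^2)\operatorname{arth} r\right)\mathcal{K}(r)}\right\}.$$
   Context: $\operatorname{arth}$ denotes the inverse hyperbolic tangent. For $r\in(0,1)$, $\mathcal{K}(r)=\int_0^{\pi/2}(1-r^2\sin^2t)^{-1/2}\,dt$ and $\mathcal{E}(r)=\int_0^{\pi/2}(1-r^2\sin^2t)^{1/2}\,dt$ are the complete elliptic integrals of the first and second kinds. *)

(* Defs.v *)
From Stdlib Require Import Reals Lra.
From Coquelicot Require Import Coquelicot.
Open Scope R_scope.

Definition open_itv (a b : Rbar) (x : R) : Prop :=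
  Rbar_lt a x /\ Rbar_lt x b.

Definition strictly_increasing_on (D : R -> Prop) (f : R -> R) : Prop :=
  forall x y : R, D x -> D y -> x < y -> f x < f y.

Definition strictly_decreasing_on (D : R -> Prop) (f : R -> R) : Prop :=
  forall x y : R, D x -> D y -> x < y -> f y < f x.

Definition convex_on (D : R -> Prop) (f : R -> R) : Prop :=
  forall x y t : R, D x -> D y -> 0 <= t <= 1 ->
    f (t * x + (1 - t) * y) <= t * f x + (1 - t) * f y.

Definition has_range (D : R -> Prop) (f : R -> R) (S : R -> Prop) : Prop :=
  forall y : R, (exists x : R, D x /\ f x = y) <-> S y.

(* Inverse hyperbolic tangent; meaningful for -1 < r < 1, see [tanh_arth]. *)
Definition arth (r : R) : R := / 2 * ln ((1 + r) / (1 - r)).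

(* For 0 < r < 1 the integrands are continuous, so these are genuine
   Riemann integrals; see [ex_RInt_ellK] and [ex_RInt_ellE]. *)
Definition ellK (r : R) : R :=
  RInt (fun t => / sqrt (1 - r ^ 2 * sin t ^ 2)) 0 (PI / 2).

Definition ellE (r : R) : R :=
  RInt (fun t => sqrt (1 - r ^ 2 * sin t ^ 2)) 0 (PI / 2).

Definition f20 (r : R) : R :=
  (3 / 4 + 1 / 4 * r ^ 2) * (r - (1 - r ^ 2) * arth r) * ellK r
  - (ellE r - (1 - r ^ 2) * ellK r) * arth r.

Definition f21 (r : R) : R :=
  (ellE r - (1 - r ^ 2) * ellK r) * arth r
  - (3 / 4 + 1 / 160 * r ^ 2) * (r - (1 - r ^ 2) * arth r) * ellK r.

Definition f22 (r : R) : R :=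
  ((r - (1 - r ^ 2) * arth r) * ellE r
   - 2 * (1 - r ^ 2) * (arth r - r) * ellK r) / r ^ 5.

Definition f23 (r : R) : R :=
  2 * ((1 - r ^ 2) * arth r / r) * ellK r
  + (r - (1 - r ^ 2) * arth r) / r ^ 3 * ellE r.

Definition f24 (r : R) : R :=
  1 / r ^ 2 *
  (4 * ((ellE r - (1 - r ^ 2) * ellK r) * arth r
        / ((r - (1 - r ^ 2) * arth r) * ellK r)) - 3).

Definition P4 (r : R) : R :=
  Rmax (1 / 40)
       (1 - ln 16 / (r * (r - (1 - r ^ 2) * arth r) * ellK r)).

Lemma tanh_arth (r : R) : -1 < r < 1 -> tanh (arth r) = r.
Proof.
intros Hr; unfold tanh, sinh, cosh.
assert (Hq : 0 < (1 + r) / (1 - r)) by (apply Rdiv_lt_0_compat; lra).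
assert (H2 : exp (arth r) * exp (arth r) = (1 + r) / (1 - r)).
{ rewrite <- exp_plus.
  replace (arth r + arth r) with (ln ((1 + r) / (1 - r)))
    by (unfold arth; field).
  now apply exp_ln. }
rewrite exp_Ropp.
assert (He := exp_pos (arth r)).
set (e := exp (arth r)) in *.
assert (H3 : e * e * (1 - r) = 1 + r) by (rewrite H2; field; lra).
replace ((e - / e) / 2 / ((e + / e) / 2)) with ((e * e - 1) / (e * e + 1)).
- apply Rmult_eq_reg_r with (e * e + 1); [|nra].
  unfold Rdiv; rewrite Rmult_assoc, Rinv_l, Rmult_1_r by nra; lra.
- field; nra.
Qed.

Lemma ell_radicand_pos (r t : R) : 0 < r < 1 -> 0 < 1 - r ^ 2 * sin t ^ 2.
Proof.
intros Hr.
assert (Hs : 0 <= sin t ^ 2 <= 1).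
{ assert (H := sin2_cos2 t); unfold Rsqr in H.
  assert (H' := Rle_0_sqr (cos t)); assert (H'' := Rle_0_sqr (sin t)).
  unfold Rsqr in *; simpl; lra. }
assert (r ^ 2 < 1) by nra.
nra.
Qed.

Lemma continuous_ell_radicand (r t : R) :
  continuous (fun u => 1 - r ^ 2 * sin u ^ 2) t.
Proof.
apply (ex_derive_continuous (V := R_NormedModule)); auto_derive; auto.
Qed.

Lemma ex_RInt_ellE (r : R) : 0 < r < 1 ->
  ex_RInt (fun t => sqrt (1 - r ^ 2 * sin t ^ 2)) 0 (PI / 2).
Proof.
intros Hr; apply (ex_RInt_continuous (V := R_CompleteNormedModule)); intros t _.
apply (continuous_comp (fun u => 1 - r ^ 2 * sin u ^ 2) sqrt).
- apply continuous_ell_radicand.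
- apply continuous_sqrt.
Qed.

Lemma ex_RInt_ellK (r : R) : 0 < r < 1 ->
  ex_RInt (fun t => / sqrt (1 - r ^ 2 * sin t ^ 2)) 0 (PI / 2).
Proof.
intros Hr; apply (ex_RInt_continuous (V := R_CompleteNormedModule)); intros t _.
apply (continuous_comp (fun u => sqrt (1 - r ^ 2 * sin u ^ 2)) Rinv).
- apply (continuous_comp (fun u => 1 - r ^ 2 * sin u ^ 2) sqrt).
  + apply continuous_ell_radicand.
  + apply continuous_sqrt.
- apply continuous_Rinv, Rgt_not_eq, sqrt_lt_R0, ell_radicand_pos, Hr.
Qed.

(* Main.v *)
Require Import Defs.
From Stdlib Require Import Reals Lra Lia Psatz Ranalysis5 Wf_nat.
From Coquelicot Require Import Coquelicot.
Open Scope R_scope.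

(** Put [x = r^2].  The expansions of [K], [E] and [arth r / r] in powers of
    [x] make each of the functions, up to a power of [r], a power series whose
    coefficients are rational combinations of [k_n = (C(2n,n)/4^n)^2] and of
    the coefficient [u_n] of [K arth r / r].  The convolution defining [u_n]
    telescopes into [(2n+3)^2 u_(n+1) = (2n+2)^2 u_n + (4n+5) k_(n+1)], which
    propagates the bounds
    [(2n+1)/(n+1) <= u_n/k_n <= (3n^2+12n+4)/(4(n+1))], and these decide the sign
    of every coefficient.  For [f24 = 1 - 4 f20 / (r^2 (r - (1-r^2) arth r) K)]
    the quotients of corresponding coefficients decrease, hence so does the
    quotient of the series.  The behaviour at [1] comes from
    [arth r / r = int sin t / sqrt (1 - r^2 sin^2 t) dt], which gives
    [K - arth r / r -> int cos t / (1 + sin t) dt = ln 2]. *)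

(** * Coefficient sequences *)

(** The constants of the statement come from the two ends of the interval. Write X = r - (1 - r^2)
    arth r and Y = (E - (1 - r^2) K) arth r. At 0, X K and Y begin with PI r^3 / 3 and PI r^3 / 4,
    whence 3/4 and the division of [f20] and [f21] by r^5. The weight 1/4 makes 3/4 + r^2/4 equal to
    1 at r = 1, which is what cancels the divergent parts of X K and Y there; 1/160 is the weight
    for which the r^5 term of [f21] vanishes. Multiplied by 4, these weights are the end values 1
    and 1/40 of [f24]. Both [f21] and [f24] are reduced to [f20], through f20 + f21 = (39/160) r^2 X
    K and the quotient of [f20] by r^2 X K. Nonnegative coefficients in powers of r give
    monotonicity and convexity at once, so no derivative of K or E is ever taken. *)

Fixpoint cbinom (n : nat) : R :=
  match n with
  | O => 1
  | S p => cbinom p * ((2 * INR p + 1) / (2 * INR p + 2))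
  end.

Definition kcoef (n : nat) : R := cbinom n ^ 2.

Definition ecoef (n : nat) : R := - kcoef n / (2 * INR n - 1).

Definition akcoef (n : nat) : R :=
  sum_f_R0 (fun j => kcoef j * / (2 * INR (n - j) + 1)) n.

Definition aecoef (n : nat) : R :=
  sum_f_R0 (fun j => ecoef j * / (2 * INR (n - j) + 1)) n.

Lemma cbinom_pos (n : nat) : 0 < cbinom n.
Proof.
induction n as [|n IH]; simpl; [lra|].
assert (H := pos_INR n).
apply Rmult_lt_0_compat; [exact IH | apply Rdiv_lt_0_compat; lra].
Qed.

Lemma cbinom_le_1 (n : nat) : cbinom n <= 1.
Proof.
induction n as [|n IH]; simpl; [lra|].
assert (H := pos_INR n); assert (Hp := cbinom_pos n).
apply Rle_trans with (cbinom n * 1); [|lra].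
apply Rmult_le_compat_l; [lra|].
apply Rle_div_l; lra.
Qed.

Lemma kcoef_pos (n : nat) : 0 < kcoef n.
Proof. apply pow_lt, cbinom_pos. Qed.

Lemma kcoef_S (n : nat) :
  kcoef (S n) = kcoef n * ((2 * INR n + 1) / (2 * INR n + 2)) ^ 2.
Proof. unfold kcoef; simpl; ring. Qed.

Lemma two_INR_sub_1_neq_0 (n : nat) : 2 * INR n - 1 <> 0.
Proof.
destruct n as [|n]; [simpl; lra|].
rewrite S_INR; assert (H := pos_INR n); lra.
Qed.

(** The form in which termwise integration produces the coefficient: that of sqrt (1 - z) times the
    Wallis factor [cbinom]. *)
Lemma ecoef_cbinom (n : nat) :
  ecoef (S n) = (cbinom (S n) - cbinom n) * cbinom (S n).
Proof.
unfold ecoef, kcoef; rewrite S_INR; simpl.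
assert (H := pos_INR n); field; lra.
Qed.

(** Coefficient form of d(r K)/dr = E / (1 - r^2): partial sums are the coefficients of the quotient
    by 1 - x. *)
Lemma sum_ecoef (n : nat) :
  sum_f_R0 ecoef n = (2 * INR n + 1) * kcoef n.
Proof.
induction n as [|n IH].
- unfold ecoef, kcoef; simpl; field.
- rewrite tech5, IH; unfold ecoef; rewrite kcoef_S, S_INR.
  assert (H := pos_INR n); field; lra.
Qed.

(* The two convolutions telescope (Zeilberger): with n = N + 1 the summand of
   (2n+1)^2 u_n - (2n)^2 u_N is G_j - G_(j+1), G_j = 4 j^2 k_j / (2(n-j)+1). *)
Lemma akcoef_telescope (N p : nat) : (p <= N)%nat ->
  sum_f_R0 (fun j => (2 * INR N + 3) ^ 2 * (kcoef j * / (2 * INR (S N - j) + 1))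
    - (2 * INR N + 2) ^ 2 * (kcoef j * / (2 * INR (N - j) + 1))) p
  = - 4 * (INR p + 1) ^ 2 * kcoef (S p) / (2 * INR (N - p) + 1).
Proof.
induction p as [|p IH]; intros Hp.
- rewrite kcoef_S; cbn [sum_f_R0]; rewrite !Nat.sub_0_r, S_INR; cbn [INR].
  assert (H := pos_INR N); unfold kcoef; simpl; field; lra.
- rewrite tech5, IH by lia.
  replace (N - p)%nat with (S (N - S p)) by lia.
  replace (S N - S p)%nat with (S (N - S p)) by lia.
  set (q := (N - S p)%nat).
  assert (HN : INR N = INR q + INR p + 1).
  { rewrite <- plus_INR, <- S_INR; f_equal; lia. }
  rewrite HN, (kcoef_S (S p)), !S_INR.
  assert (H := pos_INR q); assert (H' := pos_INR p).
  field; lra.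
Qed.

Lemma akcoef_S (n : nat) :
  akcoef (S n) = ((2 * INR n + 2) ^ 2 * akcoef n
                  + (4 * INR n + 5) * kcoef (S n)) / (2 * INR n + 3) ^ 2.
Proof.
assert (H := pos_INR n).
assert (T := akcoef_telescope n n (le_n n)).
rewrite minus_sum in T.
assert (E1 : sum_f_R0 (fun j => (2 * INR n + 3) ^ 2
      * (kcoef j * / (2 * INR (S n - j) + 1))) n
    = (2 * INR n + 3) ^ 2 * sum_f_R0 (fun j => kcoef j * / (2 * INR (S n - j) + 1)) n).
{ rewrite scal_sum; apply sum_eq; intros; ring. }
assert (E2 : sum_f_R0 (fun j => (2 * INR n + 2) ^ 2
      * (kcoef j * / (2 * INR (n - j) + 1))) n
    = (2 * INR n + 2) ^ 2 * akcoef n).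
{ unfold akcoef; rewrite scal_sum; apply sum_eq; intros; ring. }
rewrite E1, E2, Nat.sub_diag in T; cbn [INR] in T.
(* The last term, j = n + 1, lies outside the telescoped range; with it the factor of [kcoef (S n)]
   becomes (2n+3)^2 - 4(n+1)^2 = 4n+5. *)
unfold akcoef at 1; rewrite tech5, Nat.sub_diag; cbn [INR].
set (s := sum_f_R0 _ n) in *.
replace s with (((2 * INR n + 2) ^ 2 * akcoef n
   + - 4 * (INR n + 1) ^ 2 * kcoef (S n) / (2 * 0 + 1)) / (2 * INR n + 3) ^ 2).
- field; lra.
- rewrite <- T; field; lra.
Qed.

(** Partial fractions: the denominators 2j - 1 and 2(n + 1 - j) + 1 add up to 2n + 2, so the
    convolution splits into a partial sum of [ecoef] and the convolution [akcoef]. *)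
Lemma aecoef_S (n : nat) :
  aecoef (S n) = ((2 * INR n + 3) * kcoef (S n) - akcoef (S n)) / (2 * INR n + 2).
Proof.
assert (H := pos_INR n).
assert (T : (2 * INR n + 2) * aecoef (S n) = sum_f_R0 ecoef (S n) - akcoef (S n)).
{ unfold aecoef, akcoef; rewrite <- minus_sum, scal_sum; apply sum_eq; intros j Hj.
  rewrite minus_INR, S_INR by exact Hj; unfold ecoef.
  assert (Hj' : INR j <= INR n + 1) by (rewrite <- S_INR; apply le_INR, Hj).
  assert (H2 := two_INR_sub_1_neq_0 j).
  field; split; lra. }
rewrite sum_ecoef, S_INR in T.
apply Rmult_eq_reg_l with (2 * INR n + 2); [rewrite T; field|]; lra.
Qed.

(** * Power series with nonnegative coefficients *)

Lemma is_series_nonneg_ge (a : nat -> R) (l : R) (N : nat) :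
  (forall n, 0 <= a n) -> is_series a l -> a N <= l.
Proof.
intros Ha Hl.
apply Rle_trans with (sum_n a N).
- destruct N as [|N]; [rewrite sum_O; apply Rle_refl|].
  rewrite sum_Sn; change (a (S N) <= sum_n a N + a (S N)).
  assert (0 <= sum_n a N); [|lra].
  induction N as [|N IH]; [rewrite sum_O; apply Ha|].
  rewrite sum_Sn; apply Rplus_le_le_0_compat; [exact IH | apply Ha].
- apply (is_lim_seq_incr_compare (sum_n a)); [exact Hl|].
  intros n; rewrite sum_Sn; change (sum_n a n <= sum_n a n + a (S n)).
  specialize (Ha (S n)); lra.
Qed.

Lemma is_series_minus_R (a b : nat -> R) (la lb : R) :
  is_series a la -> is_series b lb -> is_series (fun n => a n - b n) (la - lb).
Proof. intros Ha Hb; exact (is_series_minus a b la lb Ha Hb). Qed.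

Lemma is_series_plus_R (a b : nat -> R) (la lb : R) :
  is_series a la -> is_series b lb -> is_series (fun n => a n + b n) (la + lb).
Proof. intros Ha Hb; exact (is_series_plus a b la lb Ha Hb). Qed.

Lemma is_series_scal_R (c : R) (a : nat -> R) (l : R) :
  is_series a l -> is_series (fun n => c * a n) (c * l).
Proof. intros Ha; exact (is_series_scal c a l Ha). Qed.

Lemma is_series_ext_R (a b : nat -> R) (l : R) :
  (forall n, a n = b n) -> is_series a l -> is_series b l.
Proof. exact (is_series_ext a b l). Qed.

Lemma is_series_le (a b : nat -> R) (la lb : R) :
  (forall n, a n <= b n) -> is_series a la -> is_series b lb -> la <= lb.
Proof.
intros H Ha Hb.
assert (T := is_series_nonneg_ge _ _ 0 (fun n => Rge_le _ _ (Rge_minus _ _ (Rle_ge _ _ (H n))))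
  (is_series_minus_R b a lb la Hb Ha)).
specialize (H 0%nat); simpl in T; lra.
Qed.

Lemma is_series_lt (a b : nat -> R) (la lb : R) (N : nat) :
  (forall n, a n <= b n) -> a N < b N -> is_series a la -> is_series b lb ->
  la < lb.
Proof.
intros H HN Ha Hb.
assert (T := is_series_nonneg_ge _ _ N (fun n => Rge_le _ _ (Rge_minus _ _ (Rle_ge _ _ (H n))))
  (is_series_minus_R b a lb la Hb Ha)).
simpl in T; lra.
Qed.

Lemma is_series_shift (a : nat -> R) (x l : R) : x <> 0 ->
  is_series (fun n => a n * x ^ n) l ->
  is_series (fun n => a (S n) * x ^ n) ((l - a 0%nat) / x).
Proof.
intros Hx H.
apply is_series_ext_R with (fun n => / x * (a (S n) * x ^ S n)).
- intros n; simpl; field; exact Hx.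
- replace ((l - a 0%nat) / x) with (/ x * (l - a 0%nat)) by (field; exact Hx).
  apply is_series_scal_R.
  apply (is_series_incr_1 (fun n => a n * x ^ n)).
  replace (plus _ _) with l; [exact H|].
  unfold plus; simpl; ring.
Qed.

Lemma pow_convex (x y t : R) (n : nat) :
  0 <= x -> 0 <= y -> 0 <= t <= 1 ->
  (t * x + (1 - t) * y) ^ n <= t * x ^ n + (1 - t) * y ^ n.
Proof.
intros Hx Hy Ht; induction n as [|n IH]; [simpl; lra|].
simpl.
apply Rle_trans with ((t * x + (1 - t) * y) * (t * x ^ n + (1 - t) * y ^ n)).
- apply Rmult_le_compat_l; [nra | exact IH].
(* The excess of the right side is t (1 - t) (x - y) (x^n - y^n), where both differences have the
   same sign. *)
- assert (Hm : 0 <= (x - y) * (x ^ n - y ^ n)).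
  { destruct (Rle_dec x y) as [H|H].
    - assert (x ^ n <= y ^ n) by (apply pow_incr; lra); nra.
    - assert (y ^ n <= x ^ n) by (apply pow_incr; lra); nra. }
  assert (Ht' : 0 <= t * (1 - t)) by nra.
  assert (Hp := Rmult_le_pos _ _ Ht' Hm).
  apply Rminus_le; apply Rle_trans with (- (t * (1 - t) * ((x - y) * (x ^ n - y ^ n)))).
  + right; ring.
  + lra.
Qed.

Lemma pow_lt_compat (x y : R) (n : nat) :
  0 <= x < y -> (0 < n)%nat -> x ^ n < y ^ n.
Proof.
intros Hxy Hn; destruct n as [|n]; [lia|]; clear Hn.
induction n as [|n IH]; [simpl; lra|].
change (x * x ^ S n < y * y ^ S n).
assert (H := pow_le x (S n) (proj1 Hxy)); nra.
Qed.

(** The guard [0 < 2 * n + p] sets apart the constant term, which exists only for p = 0 and cannot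
    supply strictness. *)
Lemma power_series_increasing (a : nat -> R) (p : nat) (f : R -> R) (N : nat) :
  (forall r, 0 < r < 1 -> is_series (fun n => a n * r ^ (2 * n + p)) (f r)) ->
  (forall n, (0 < 2 * n + p)%nat -> 0 <= a n) ->
  (0 < 2 * N + p)%nat -> 0 < a N ->
  strictly_increasing_on (open_itv 0 1) f.
Proof.
intros Hf Ha HN HaN x y [Hx0 Hx1] [Hy0 Hy1] Hxy; simpl in Hx0, Hx1, Hy0, Hy1.
apply (is_series_lt (fun n => a n * x ^ (2 * n + p))
  (fun n => a n * y ^ (2 * n + p)) _ _ N).
- intros n; destruct (2 * n + p)%nat as [|m] eqn:E; [simpl; lra|].
  rewrite <- E; apply Rmult_le_compat_l; [apply Ha; lia | apply pow_incr; lra].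
- apply Rmult_lt_compat_l; [exact HaN | apply pow_lt_compat; [lra | exact HN]].
- apply Hf; lra.
- apply Hf; lra.
Qed.

Lemma power_series_convex (a : nat -> R) (p : nat) (f : R -> R) :
  (forall r, 0 < r < 1 -> is_series (fun n => a n * r ^ (2 * n + p)) (f r)) ->
  (forall n, 0 <= a n) ->
  convex_on (open_itv 0 1) f.
Proof.
intros Hf Ha x y t [Hx0 Hx1] [Hy0 Hy1] Ht; simpl in Hx0, Hx1, Hy0, Hy1.
assert (Hxy : 0 < t * x + (1 - t) * y < 1) by (destruct (Rle_dec x y); split; nra).
apply (is_series_le (fun n => a n * (t * x + (1 - t) * y) ^ (2 * n + p))
  (fun n => t * (a n * x ^ (2 * n + p)) + (1 - t) * (a n * y ^ (2 * n + p)))).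
- intros n; apply Rle_trans with
    (a n * (t * x ^ (2 * n + p) + (1 - t) * y ^ (2 * n + p))); [|right; ring].
  apply Rmult_le_compat_l; [apply Ha | apply pow_convex; lra].
- apply Hf, Hxy.
- apply is_series_plus_R; apply is_series_scal_R; apply Hf; lra.
Qed.

(** Convergence at the midpoint between |x| and 1 bounds the terms there. The conclusion also covers
    x = 0, where limits from the right will be read off. *)
Lemma CV_radius_ge_1 (a : nat -> R) (l : R -> R) (x : R) :
  (forall z, 0 < z < 1 -> is_series (fun n => a n * z ^ n) (l z)) ->
  Rabs x < 1 -> Rbar_lt (Rabs x) (CV_radius a).
Proof.
intros H Hx.
assert (Hx0 := Rabs_pos x).
set (z := (Rabs x + 1) / 2).
assert (Hz : Rabs x < z < 1) by (unfold z; lra).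
apply Rbar_lt_le_trans with (Finite z); [apply Hz|].
apply (proj1 (CV_radius_bounded a)).
assert (Hl : is_lim_seq (fun n => a n * z ^ n) 0).
{ apply ex_series_lim_0; exists (l z); apply H; lra. }
destruct (filterlim_bounded (fun n => a n * z ^ n)) as [M HM].
{ exists 0; exact Hl. }
exists M; exact HM.
Qed.

Lemma PSeries_continuity_1 (a : nat -> R) (l : R -> R) (x : R) :
  (forall z, 0 < z < 1 -> is_series (fun n => a n * z ^ n) (l z)) ->
  Rabs x < 1 -> continuity_pt (PSeries a) x.
Proof.
intros H Hx; apply PSeries_continuity, (CV_radius_ge_1 a l); assumption.
Qed.

(* With [y] fixed and [l = C y / D y], the coefficients [c n - l * d n] change
   sign once, at [m]; replacing [(x / y) ^ n] by [(x / y) ^ m] only decreases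
   the series of [c - l d] at [x], and leaves a multiple of [C y - l D y = 0]. *)
Lemma power_series_quotient_decreasing (c d : nat -> R) (x y Cx Dx Cy Dy : R) :
  0 < x < y ->
  (forall n, 0 < d n) -> (forall n, c (S n) * d n < c n * d (S n)) ->
  is_series (fun n => c n * x ^ n) Cx -> is_series (fun n => d n * x ^ n) Dx ->
  is_series (fun n => c n * y ^ n) Cy -> is_series (fun n => d n * y ^ n) Dy ->
  Cy / Dy < Cx / Dx.
Proof.
intros Hxy Hd Hcd HCx HDx HCy HDy.
assert (Hpos : forall z Z, 0 < z -> is_series (fun n => d n * z ^ n) Z -> 0 < Z).
{ intros z Z Hz HZ; apply Rlt_le_trans with (d 0%nat * z ^ 0).
  - simpl; specialize (Hd 0%nat); lra.
  - apply (is_series_nonneg_ge (fun n => d n * z ^ n) Z 0%nat); [|exact HZ].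
    intros n; apply Rmult_le_pos; [apply Rlt_le, Hd | apply pow_le; lra]. }
assert (HDx0 := Hpos x Dx (proj1 Hxy) HDx).
assert (Hy : 0 < y) by lra.
assert (HDy0 := Hpos y Dy Hy HDy).
set (l := Cy / Dy).
pose (g := fun n => c n / d n - l).
assert (Hg : forall n, c n - l * d n = d n * g n).
{ intros n; unfold g; field; apply Rgt_not_eq, Hd. }
assert (Hgdec : forall n, g (S n) < g n).
{ intros n; unfold g; apply Rplus_lt_compat_r.
  assert (H1 := Hd n); assert (H2 := Hd (S n)).
  apply Rmult_lt_reg_r with (d n * d (S n)); [nra|].
  replace (c (S n) / d (S n) * (d n * d (S n))) with (c (S n) * d n) by (field; lra).
  replace (c n / d n * (d n * d (S n))) with (c n * d (S n)) by (field; lra).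
  apply Hcd. }
assert (Hgmon : forall n m, (n <= m)%nat -> g m <= g n).
{ intros n m Hnm; induction Hnm as [|m Hnm IH]; [apply Rle_refl|].
  specialize (Hgdec m); lra. }
assert (Hsx : is_series (fun n => d n * g n * x ^ n) (Cx - l * Dx)).
{ apply is_series_ext_R with (fun n => c n * x ^ n - l * (d n * x ^ n)).
  - intros n; rewrite <- Hg; ring.
  - apply is_series_minus_R; [exact HCx | apply is_series_scal_R, HDx]. }
assert (Hsy : is_series (fun n => d n * g n * y ^ n) 0).
{ apply is_series_ext_R with (fun n => c n * y ^ n - l * (d n * y ^ n)).
  - intros n; rewrite <- Hg; ring.
  - replace 0 with (Cy - l * Dy) by (unfold l; field; lra).
    apply is_series_minus_R; [exact HCy | apply is_series_scal_R, HDy]. }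
(* If every [g n] were nonnegative, the series at y would have a positive term and could not sum to
   0. The least index with a negative value is then the place of the sign change. *)
assert (Hneg : exists m, g m < 0 /\ forall n, (n < m)%nat -> 0 <= g n).
{ assert (He : exists m, g m < 0).
  { apply Classical_Prop.NNPP; intros Hn.
    assert (Hall : forall n, 0 <= g n).
    { intros n; apply Rnot_lt_le; intros H; apply Hn; exists n; exact H. }
    assert (H0 : 0 < 0); [|lra].
    apply (is_series_lt (fun _ => 0) (fun n => d n * g n * y ^ n) _ _ 0%nat).
    - intros n; apply Rmult_le_pos; [|apply pow_le; lra].
      apply Rmult_le_pos; [apply Rlt_le, Hd | apply Hall].
    - simpl; specialize (Hall 1%nat); specialize (Hgdec 0%nat); specialize (Hd 0%nat).
      nra.
    - assert (Hz := is_series_scal_R 0 _ _ Hsy); rewrite Rmult_0_l in Hz.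
      apply is_series_ext_R with (2 := Hz).
      intros n; apply Rmult_0_l.
    - exact Hsy. }
  destruct He as [M HM].
  revert HM; induction M as [M IH] using lt_wf_ind; intros HM.
  destruct (Classical_Prop.classic (exists n, (n < M)%nat /\ g n < 0)) as [[n [Hn Hgn]]|Hno].
  - exact (IH n Hn Hgn).
  - exists M; split; [exact HM|]; intros n Hn.
    apply Rnot_lt_le; intros H; apply Hno; exists n; split; assumption. }
destruct Hneg as [m [Hm Hlt]].
set (q := x / y).
assert (Hq : 0 < q < 1).
{ unfold q; split; [apply Rdiv_lt_0_compat; lra | apply Rlt_div_l; lra]. }
assert (Hxq : forall n, x ^ n = q ^ n * y ^ n).
{ intros n; rewrite <- Rpow_mult_distr; f_equal; unfold q; field; lra. }
assert (Hqdec : forall i j, q ^ (i + j) <= q ^ i).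
{ intros i j; rewrite pow_add; assert (H1 := pow_le q i (Rlt_le _ _ (proj1 Hq))).
  assert (H2 : q ^ j <= 1) by (rewrite <- (pow1 j); apply pow_incr; lra).
  nra. }
assert (H0 : q ^ m * 0 < Cx - l * Dx).
(* Strictness is taken at m + 1, since the two terms of index m are equal. *)
{ apply (is_series_lt (fun n => q ^ m * (d n * g n * y ^ n))
    (fun n => d n * g n * x ^ n) _ _ (S m)).
  - intros n; rewrite Hxq.
    assert (Hdy : 0 < d n * y ^ n) by (apply Rmult_lt_0_compat; [apply Hd | apply pow_lt; lra]).
    (* Before m both factors are nonnegative, from m on both are nonpositive. *)
    assert (Hs : 0 <= g n * (q ^ n - q ^ m)).
    { destruct (Nat.lt_ge_cases n m) as [H|H].
      - assert (Hgn := Hlt n H); assert (Hp := Hqdec n (m - n)%nat).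
        replace (n + (m - n))%nat with m in Hp by lia; nra.
      - assert (Hgn := Hgmon m n H); assert (Hp := Hqdec m (n - m)%nat).
        replace (m + (n - m))%nat with n in Hp by lia; nra. }
    assert (Hp := Rmult_le_pos _ _ (Rlt_le _ _ Hdy) Hs).
    apply Rminus_le; apply Rle_trans with (- (d n * y ^ n * (g n * (q ^ n - q ^ m)))).
    + right; ring.
    + lra.
  - rewrite Hxq.
    assert (Hdy : 0 < d (S m) * y ^ S m) by (apply Rmult_lt_0_compat; [apply Hd | apply pow_lt; lra]).
    assert (Hgm := Hgdec m).
    assert (Hqm : 0 < q ^ m) by (apply pow_lt; lra).
    assert (Hs : 0 < g (S m) * (q ^ S m - q ^ m)).
    { simpl; assert (q * q ^ m < q ^ m) by nra; nra. }
    assert (Hp := Rmult_lt_0_compat _ _ Hdy Hs).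
    apply Rminus_lt; apply Rle_lt_trans with
      (- (d (S m) * y ^ S m * (g (S m) * (q ^ S m - q ^ m)))).
    + right; ring.
    + lra.
  - apply is_series_scal_R, Hsy.
  - exact Hsx. }
apply Rmult_lt_reg_r with Dx; [exact HDx0|].
replace (Cx / Dx * Dx) with Cx by (field; lra).
lra.
Qed.

(** The end limits bound f weakly; they are not attained, because a point between x and the end of
    the interval already separates [f x] from the limit. The intermediate value theorem fills the
    rest, and extended limits cover an unbounded range. *)
Lemma increasing_has_range (f : R -> R) (l L : Rbar) :
  strictly_increasing_on (open_itv 0 1) f ->
  (forall r, 0 < r < 1 -> continuity_pt f r) ->
  filterlim f (at_right 0) (Rbar_locally l) ->
  filterlim f (at_left 1) (Rbar_locally L) ->
  has_range (open_itv 0 1) f (open_itv l L).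
Proof.
intros Hinc Hc Hl HL.
assert (near0 : forall b, 0 < b -> at_right 0 (fun z => 0 < z < b)).
{ intros b Hb; exists (mkposreal b Hb); intros z Hz Hz0.
  apply Rabs_def2 in Hz; unfold minus, plus, opp in Hz; simpl in Hz; lra. }
assert (near1 : forall b, b < 1 -> at_left 1 (fun z => b < z < 1)).
{ intros b Hb; assert (Hb' : 0 < 1 - b) by lra.
  exists (mkposreal _ Hb'); intros z Hz Hz0.
  apply Rabs_def2 in Hz; unfold minus, plus, opp in Hz; simpl in Hz; lra. }
assert (lower : forall x, 0 < x < 1 -> Rbar_le l (f x)).
{ intros x Hx; apply (filterlim_le (F := at_right 0) f (fun _ => f x)).
  - apply filter_imp with (2 := near0 x (proj1 Hx)); intros z Hz.
    apply Rlt_le, Hinc; simpl; try split; simpl; lra.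
  - exact Hl.
  - apply filterlim_const. }
assert (upper : forall x, 0 < x < 1 -> Rbar_le (f x) L).
{ intros x Hx; apply (filterlim_le (F := at_left 1) (fun _ => f x) f).
  - apply filter_imp with (2 := near1 x (proj2 Hx)); intros z Hz.
    apply Rlt_le, Hinc; simpl; try split; simpl; lra.
  - apply filterlim_const.
  - exact HL. }
intros y; split.
- intros [x [[Hx0 Hx1] <-]]; simpl in Hx0, Hx1; split.
  + apply Rbar_le_lt_trans with (Finite (f (x / 2))); [apply lower; lra|].
    apply Hinc; try split; simpl; lra.
  + apply Rbar_lt_le_trans with (Finite (f ((x + 1) / 2))); [|apply upper; lra].
    apply Hinc; try split; simpl; lra.
- intros [Hy1 Hy2].
  assert (Ha : exists a, 0 < a < 1 /\ f a < y).
  { assert (Ha := Hl _ (open_Rbar_lt' _ _ Hy1)).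
    assert (Hb := filter_and (F := at_right 0) _ _ Ha (near0 1 Rlt_0_1)).
    destruct (filter_ex _ Hb) as [a [H1 H2]]; exists a; split; assumption. }
  assert (Hb : exists b, 0 < b < 1 /\ y < f b).
  { assert (Ha' := HL _ (open_Rbar_gt' _ _ Hy2)).
    assert (Hb := filter_and (F := at_left 1) _ _ Ha' (near1 0 Rlt_0_1)).
    destruct (filter_ex _ Hb) as [a [H1 H2]]; exists a; split; assumption. }
  destruct Ha as [a [Ha Hfa]]; destruct Hb as [b [Hb Hfb]].
  assert (Hab : a < b).
  { destruct (Rtotal_order a b) as [H|[H|H]]; [exact H| subst; lra|].
    assert (f b < f a) by (apply Hinc; try split; simpl; lra); lra. }
  destruct (IVT_interv (fun z => f z - y) a b) as [x [Hx Hfx]]; try lra.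
  + intros z Hz; apply continuity_pt_minus; [apply Hc; lra|].
    apply continuity_pt_const; intros ? ?; reflexivity.
  + exists x; split; [split; simpl; lra | lra].
Qed.

(** * Expansions of the elliptic integrals and of arth *)

Lemma is_series_unshift (a : nat -> R) (x l : R) :
  is_series (fun n => a n * x ^ n) l ->
  is_series (fun n => match n with O => 0 | S p => a p end * x ^ n) (x * l).
Proof.
intros H; apply is_series_decr_1.
replace (plus _ _) with (x * l) by (unfold plus, opp; simpl; ring).
apply is_series_ext_R with (2 := is_series_scal_R x _ _ H).
intros n; simpl; ring.
Qed.

Lemma bounded_power_series (a : nat -> R) (z : R) :
  (forall n, Rabs (a n) <= 1) -> Rabs z < 1 ->
  is_series (fun n => a n * z ^ n) (PSeries a z).
Proof.
intros Ha Hz; apply Series_correct.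
apply (ex_series_le (V := R_CompleteNormedModule) _ (fun n => Rabs z ^ n)).
- intros n; unfold norm; simpl; unfold abs; simpl.
  rewrite Rabs_mult, <- RPow_abs; rewrite <- (Rmult_1_l (Rabs z ^ n)) at 2.
  apply Rmult_le_compat_r; [apply pow_le, Rabs_pos | apply Ha].
- eexists; apply is_series_geom; rewrite Rabs_Rabsolu; exact Hz.
Qed.

Lemma bounded_CV_radius (a : nat -> R) (z : R) :
  (forall n, Rabs (a n) <= 1) -> Rabs z < 1 -> Rbar_lt (Rabs z) (CV_radius a).
Proof.
intros Ha; apply (CV_radius_ge_1 a (PSeries a)); intros w Hw.
apply bounded_power_series; [exact Ha | rewrite Rabs_pos_eq; lra].
Qed.

Lemma bounded_power_series_derive (a : nat -> R) (z : R) :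
  (forall n, Rabs (a n) <= 1) -> Rabs z < 1 ->
  exists d, is_derive (PSeries a) z d /\
    is_series (fun n => INR (S n) * a (S n) * z ^ n) d /\
    is_series (fun n => INR n * a n * z ^ n) (z * d).
Proof.
intros Ha Hz; assert (Hr := bounded_CV_radius a z Ha Hz).
exists (Derive (PSeries a) z).
assert (H : is_series (fun n => INR (S n) * a (S n) * z ^ n) (Derive (PSeries a) z)).
{ apply (proj1 (is_pseries_R (PS_derive a) z _)), is_pseries_derive, Hr. }
split; [|split; [exact H|]].
- rewrite (is_derive_unique _ _ _ (is_derive_PSeries a z Hr)).
  apply is_derive_PSeries, Hr.
- apply is_series_ext_R with (2 := is_series_unshift _ _ _ H).
  intros [|n]; simpl INR; ring.
Qed.

Lemma Rabs_cbinom (n : nat) : Rabs (cbinom n) <= 1.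
Proof.
rewrite Rabs_pos_eq; [apply cbinom_le_1 | apply Rlt_le, cbinom_pos].
Qed.

(* [S = sum C(2n,n) (z/4)^n] satisfies [2 (1 - z) S' = S], so that
   [S^2 (1 - z)] is constant. *)
Lemma inv_sqrt_series (z : R) : 0 <= z < 1 ->
  is_series (fun n => cbinom n * z ^ n) (/ sqrt (1 - z)).
Proof.
intros Hz.
assert (HS : forall w, 0 <= w < 1 ->
  is_series (fun n => cbinom n * w ^ n) (PSeries cbinom w)).
{ intros w Hw; apply bounded_power_series; [apply Rabs_cbinom|].
  rewrite Rabs_pos_eq; lra. }
assert (Hd : forall w, 0 <= w < 1 ->
  is_derive (fun w => PSeries cbinom w ^ 2 * (1 - w)) w 0).
{ intros w Hw.
  destruct (bounded_power_series_derive cbinom w Rabs_cbinom) as [d [Hd [H1 H2]]].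
  { rewrite Rabs_pos_eq; lra. }
  (* Coefficientwise this is 2(n+1) c_(n+1) = (2n+1) c_n, the recursion that defines [cbinom]. *)
  assert (E : 2 * d = PSeries cbinom w + 2 * (w * d)).
  { apply is_series_scal_R with (c := 2) in H1; apply is_series_scal_R with (c := 2) in H2.
    rewrite <- (is_series_unique _ _ H1); apply is_series_unique.
    apply is_series_ext_R with (2 := is_series_plus_R _ _ _ _ (HS w Hw) H2).
    intros n; rewrite S_INR; simpl cbinom; assert (H := pos_INR n); field; lra. }
  auto_derive; [exists d; exact Hd|].
  replace (Derive (fun x : R => PSeries cbinom x) w) with d
    by (symmetry; apply is_derive_unique, Hd).
  simpl; nra. }
assert (Hc : PSeries cbinom z ^ 2 * (1 - z) = 1).
{ destruct (Req_dec z 0) as [->|Hz0].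
  - rewrite PSeries_0; simpl; ring.
  - rewrite <- (eq_is_derive (fun w => PSeries cbinom w ^ 2 * (1 - w)) 0 z).
    + rewrite PSeries_0; simpl; ring.
    + intros t Ht; apply Hd; lra.
    + lra. }
(* Positivity selects the root of S^2 (1 - z) = 1. *)
assert (Hp : 0 < PSeries cbinom z).
{ apply Rlt_le_trans with (cbinom 0 * z ^ 0); [simpl; lra|].
  apply (is_series_nonneg_ge (fun n => cbinom n * z ^ n) _ 0); [|apply HS, Hz].
  intros n; apply Rmult_le_pos; [apply Rlt_le, cbinom_pos | apply pow_le; lra]. }
replace (sqrt (1 - z)) with (/ PSeries cbinom z).
- rewrite Rinv_inv; apply HS, Hz.
- symmetry; apply sqrt_lem_1; [lra | apply Rlt_le, Rinv_0_lt_compat, Hp|].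
  apply Rmult_eq_reg_l with (PSeries cbinom z ^ 2); [rewrite Hc; field; lra | nra].
Qed.

Definition sqrt_coef (n : nat) : R :=
  match n with O => 1 | S p => cbinom (S p) - cbinom p end.

(** The series of 1 / sqrt (1 - z) multiplied by 1 - z, which takes differences of its
    coefficients. *)
Lemma sqrt_series (z : R) : 0 <= z < 1 ->
  is_series (fun n => sqrt_coef n * z ^ n) (sqrt (1 - z)).
Proof.
intros Hz; assert (H := inv_sqrt_series z Hz).
replace (sqrt (1 - z)) with (/ sqrt (1 - z) - z * / sqrt (1 - z)).
- apply is_series_ext_R with
    (2 := is_series_minus_R _ _ _ _ H (is_series_unshift _ _ _ H)).
  intros [|n]; unfold sqrt_coef; simpl; ring.
- assert (Hs := sqrt_lt_R0 (1 - z) ltac:(lra)).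
  assert (E := sqrt_sqrt (1 - z) ltac:(lra)).
  set (s := sqrt (1 - z)) in *; clearbody s.
  replace z with (1 - s * s) by lra; field; lra.
Qed.

Lemma Rabs_sqrt_coef (n : nat) : Rabs (sqrt_coef n) <= 1.
Proof.
destruct n as [|n]; unfold sqrt_coef; [rewrite Rabs_R1; lra|].
assert (H1 := cbinom_pos n); assert (H2 := cbinom_pos (S n)).
assert (H3 := cbinom_le_1 n); assert (H4 := cbinom_le_1 (S n)).
apply Rabs_le; lra.
Qed.

Lemma is_RInt_sin_pow (n : nat) :
  is_RInt (fun t => sin t ^ (2 * n)) 0 (PI / 2) (PI / 2 * cbinom n).
Proof.
induction n as [|n IH].
- apply (is_RInt_ext (fun _ => 1)); [reflexivity|].
  replace (PI / 2 * cbinom 0) with (scal (PI / 2 - 0) 1)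
    by (unfold scal; simpl; unfold mult; simpl; ring).
  apply (is_RInt_const (V := R_NormedModule)).
- assert (Hn := pos_INR n).
  (* Wallis reduction: the integrand is the derivative of - sin^(2n+1) cos, which vanishes at both
     ends. *)
  assert (H : is_RInt (fun t => (2 * INR n + 2) * sin t ^ (2 * S n)
      - (2 * INR n + 1) * sin t ^ (2 * n)) 0 (PI / 2)
      (minus (- (sin (PI / 2) ^ (2 * n + 1) * cos (PI / 2)))
             (- (sin 0 ^ (2 * n + 1) * cos 0)))).
  { apply (is_RInt_derive (fun t => - (sin t ^ (2 * n + 1) * cos t))).
    - intros t _; auto_derive; [exact I|].
      replace (Init.Nat.pred (n + (n + 0) + 1)) with (2 * n)%nat by lia.
      replace (2 * S n)%nat with (2 * n + 2)%nat by lia.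
      replace (n + (n + 0) + 1)%nat with (2 * n + 1)%nat by lia.
      rewrite !pow_add, plus_INR, mult_INR; simpl INR.
      assert (E := sin2_cos2 t); unfold Rsqr in E.
      set (X := sin t ^ (2 * n)); clearbody X.
      replace (1 * cos t * (((1 + 1) * INR n + 1) * X) * cos t)
        with ((2 * INR n + 1) * X * (cos t * cos t)) by ring.
      replace (cos t * cos t) with (1 - sin t * sin t) by lra.
      ring.
    - intros t _; apply (ex_derive_continuous (V := R_NormedModule)); auto_derive; exact I. }
  rewrite cos_PI2, sin_0 in H.
  replace (minus _ _) with 0 in H.
  2: { replace (0 ^ (2 * n + 1)) with 0 by (rewrite pow_add; simpl; ring).
       unfold minus, plus, opp; simpl; ring. }
  apply (is_RInt_scal _ _ _ (2 * INR n + 1)) in IH.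
  assert (H2 := is_RInt_scal _ _ _ (/ (2 * INR n + 2)) _ (is_RInt_plus _ _ _ _ _ _ H IH)).
  replace (PI / 2 * cbinom (S n)) with
    (scal (/ (2 * INR n + 2)) (plus 0 (scal (2 * INR n + 1) (PI / 2 * cbinom n)))).
  2: { unfold scal, plus; simpl; unfold mult; simpl; field; lra. }
  apply is_RInt_ext with (2 := H2).
  intros t _; unfold scal, plus; simpl; unfold mult; simpl; field; lra.
Qed.

(** The bound is uniform in z up to x, as needed to integrate the remainder at z = x sin^2 t. *)
Lemma bounded_series_remainder (c : nat -> R) (z x l : R) (N : nat) :
  (forall n, Rabs (c n) <= 1) -> 0 <= z <= x -> x < 1 ->
  is_series (fun n => c n * z ^ n) l ->
  Rabs (l - sum_n (fun n => c n * z ^ n) N) <= x ^ S N / (1 - x).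
Proof.
intros Hc Hz Hx H.
assert (Hr : is_series (fun k => c (S N + k)%nat * z ^ (S N + k))
  (l - sum_n (fun n => c n * z ^ n) N)).
{ apply (is_series_incr_n (fun n => c n * z ^ n) (S N)); [lia|].
  replace (plus _ _) with l; [exact H|].
  change (l = l - sum_n (fun n => c n * z ^ n) N + sum_n (fun n => c n * z ^ n) N).
  ring. }
assert (Hg : is_series (fun k => x ^ S N * x ^ k) (x ^ S N * / (1 - x))).
{ apply is_series_scal_R, is_series_geom; rewrite Rabs_pos_eq; lra. }
assert (Hb : forall k, Rabs (c (S N + k)%nat * z ^ (S N + k)) <= x ^ S N * x ^ k).
{ intros k; rewrite Rabs_mult, <- pow_add.
  rewrite (Rabs_pos_eq (z ^ _)) by (apply pow_le; lra).
  rewrite <- (Rmult_1_l (x ^ _)).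
  apply Rmult_le_compat; [apply Rabs_pos | apply pow_le; lra | apply Hc | apply pow_incr; lra]. }
unfold Rdiv; apply Rabs_le; split.
- replace (- (x ^ S N * / (1 - x))) with (-1 * (x ^ S N * / (1 - x))) by ring.
  refine (is_series_le _ _ _ _ (fun k => _) (is_series_scal_R (-1) _ _ Hg) Hr).
  specialize (Hb k); apply Rabs_le_between in Hb; simpl in *; lra.
- apply (is_series_le _ _ _ _ (fun k => Rle_trans _ _ _ (Rle_abs _) (Hb k)) Hr Hg).
Qed.

Lemma sin_sqr_bounds (t : R) : 0 <= sin t ^ 2 <= 1.
Proof.
assert (H := sin2_cos2 t); unfold Rsqr in H.
assert (H' := Rle_0_sqr (cos t)); assert (H'' := Rle_0_sqr (sin t)).
unfold Rsqr in *; simpl; lra.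
Qed.

(** Termwise integration: each power of x sin^2 t contributes a Wallis integral, and the uniform
    geometric remainder gives the convergence of the integrated partial sums. *)
Lemma is_series_RInt_sin (c : nat -> R) (f : R -> R) (x I : R) :
  (forall n, Rabs (c n) <= 1) ->
  (forall z, 0 <= z < 1 -> is_series (fun n => c n * z ^ n) (f z)) ->
  0 < x < 1 -> is_RInt (fun t => f (x * sin t ^ 2)) 0 (PI / 2) I ->
  is_series (fun n => c n * cbinom n * x ^ n) (2 / PI * I).
Proof.
intros Hc Hf Hx HI; assert (HPI := PI_RGT_0).
assert (Hsum : forall N, is_RInt (fun t => sum_n (fun n => c n * (x * sin t ^ 2) ^ n) N)
  0 (PI / 2) (PI / 2 * sum_n (fun n => c n * cbinom n * x ^ n) N)).
{ assert (Hterm : forall n, is_RInt (fun t => c n * (x * sin t ^ 2) ^ n) 0 (PI / 2)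
    (PI / 2 * (c n * cbinom n * x ^ n))).
  { intros n; assert (H := is_RInt_scal _ _ _ (c n * x ^ n) _ (is_RInt_sin_pow n)).
    replace (PI / 2 * (c n * cbinom n * x ^ n)) with (scal (c n * x ^ n) (PI / 2 * cbinom n)).
    2: { unfold scal; simpl; unfold mult; simpl; ring. }
    apply is_RInt_ext with (2 := H); intros t _.
    rewrite Rpow_mult_distr, <- pow_mult; unfold scal; simpl; unfold mult; simpl; ring. }
  induction N as [|N IH].
  - rewrite sum_O; apply is_RInt_ext with (2 := Hterm 0%nat).
    intros t _; rewrite sum_O; reflexivity.
  - rewrite sum_Sn.
    replace (PI / 2 * plus _ _) with
      (plus (PI / 2 * sum_n (fun n => c n * cbinom n * x ^ n) N)
            (PI / 2 * (c (S N) * cbinom (S N) * x ^ S N))).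
    2: { unfold plus; simpl; ring. }
    apply is_RInt_ext with (2 := is_RInt_plus _ _ _ _ _ _ IH (Hterm (S N))).
    intros t _; rewrite sum_Sn; reflexivity. }
assert (Hb : forall N, Rabs (2 / PI * I - sum_n (fun n => c n * cbinom n * x ^ n) N)
  <= x ^ S N / (1 - x)).
{ intros N.
  assert (Hd := is_RInt_minus _ _ _ _ _ _ HI (Hsum N)).
  assert (Hn := fun M H => norm_RInt_le_const _ _ _ _ M (Rlt_le _ _ PI2_RGT_0) H Hd).
  specialize (Hn (x ^ S N / (1 - x))).
  assert (Hn' : Rabs (I - PI / 2 * sum_n (fun n => c n * cbinom n * x ^ n) N)
    <= (PI / 2 - 0) * (x ^ S N / (1 - x))).
  { apply Hn; intros t _.
    assert (Hs := sin_sqr_bounds t).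
    apply (bounded_series_remainder c (x * sin t ^ 2) x); [exact Hc | nra | lra |].
    apply Hf; nra. }
  replace (2 / PI * I - sum_n (fun n => c n * cbinom n * x ^ n) N) with
    (2 / PI * (I - PI / 2 * sum_n (fun n => c n * cbinom n * x ^ n) N)) by (field; lra).
  rewrite Rabs_mult, (Rabs_pos_eq (2 / PI)).
  2: { apply Rlt_le, Rdiv_lt_0_compat; lra. }
  replace (x ^ S N / (1 - x)) with (2 / PI * ((PI / 2 - 0) * (x ^ S N / (1 - x))))
    by (field; lra).
  apply Rmult_le_compat_l; [apply Rlt_le, Rdiv_lt_0_compat; lra | exact Hn']. }
assert (Hl : is_lim_seq (fun N => 2 / PI * I - sum_n (fun n => c n * cbinom n * x ^ n) N) 0).
{ apply is_lim_seq_abs_0.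
  apply is_lim_seq_le_le with (fun _ => 0) (fun N => x / (1 - x) * x ^ N).
  - intros N; split; [apply Rabs_pos|].
    apply Rle_trans with (1 := Hb N); right; simpl; field; lra.
  - apply is_lim_seq_const.
  - replace (Finite 0) with (Rbar_mult (x / (1 - x)) 0) by (simpl; f_equal; ring).
    apply is_lim_seq_scal_l, is_lim_seq_geom; rewrite Rabs_pos_eq; lra. }
change (is_lim_seq (sum_n (fun n => c n * cbinom n * x ^ n)) (2 / PI * I)).
apply (is_lim_seq_ext (fun N => 2 / PI * I
  - (2 / PI * I - sum_n (fun n => c n * cbinom n * x ^ n) N))).
- intros N; ring.
- replace (Finite (2 / PI * I)) with (Finite (2 / PI * I - 0)) by (f_equal; ring).
  apply is_lim_seq_minus'; [apply is_lim_seq_const | exact Hl].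
Qed.

Lemma ellK_series (r : R) : 0 < r < 1 ->
  is_series (fun n => kcoef n * (r ^ 2) ^ n) (2 / PI * ellK r).
Proof.
intros Hr.
apply is_series_ext_R with (fun n => cbinom n * cbinom n * (r ^ 2) ^ n).
{ intros n; unfold kcoef; ring. }
apply (is_series_RInt_sin cbinom (fun z => / sqrt (1 - z))).
- apply Rabs_cbinom.
- apply inv_sqrt_series.
- nra.
- apply (RInt_correct (V := R_CompleteNormedModule)), ex_RInt_ellK, Hr.
Qed.

Lemma ellE_series (r : R) : 0 < r < 1 ->
  is_series (fun n => ecoef n * (r ^ 2) ^ n) (2 / PI * ellE r).
Proof.
intros Hr.
apply is_series_ext_R with (fun n => sqrt_coef n * cbinom n * (r ^ 2) ^ n).
{ intros [|n]; [unfold ecoef, kcoef; simpl; field|].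
  rewrite ecoef_cbinom; reflexivity. }
apply (is_series_RInt_sin sqrt_coef (fun z => sqrt (1 - z))).
- apply Rabs_sqrt_coef.
- apply sqrt_series.
- nra.
- apply (RInt_correct (V := R_CompleteNormedModule)), ex_RInt_ellE, Hr.
Qed.

Lemma is_derive_arth (r : R) : -1 < r < 1 -> is_derive arth r (/ (1 - r ^ 2)).
Proof.
intros Hr; unfold arth; auto_derive.
- split; [lra|split; [|exact I]].
  apply Rdiv_lt_0_compat; lra.
- field; repeat split; try nra; lra.
Qed.

Lemma Rabs_inv_odd (n : nat) : Rabs (/ (2 * INR n + 1)) <= 1.
Proof.
assert (H := pos_INR n).
rewrite Rabs_pos_eq; [|apply Rlt_le, Rinv_0_lt_compat; lra].
rewrite <- Rinv_1; apply Rinv_le_contravar; lra.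
Qed.

(** With S the sum of the series, w S(w^2) and arth w both vanish at 0, and both have derivative 1 /
    (1 - w^2): differentiating cancels the odd denominators and leaves a geometric series. *)
Lemma arth_series (r : R) : 0 < r < 1 ->
  is_series (fun n => / (2 * INR n + 1) * (r ^ 2) ^ n) (arth r / r).
Proof.
intros Hr.
set (a := fun n => / (2 * INR n + 1)).
assert (H2 : forall w, 0 <= w < 1 -> Rabs (w ^ 2) < 1).
{ intros w Hw; rewrite Rabs_pos_eq; nra. }
assert (Hd : forall w, 0 <= w < 1 ->
  is_derive (fun w => w * PSeries a (w ^ 2) - arth w) w 0).
{ intros w Hw.
  destruct (bounded_power_series_derive a (w ^ 2) Rabs_inv_odd (H2 w Hw))
    as [d [Hd [_ H]]].
  assert (E : PSeries a (w ^ 2) + 2 * (w ^ 2 * d) = / (1 - w ^ 2)).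
  { rewrite <- (is_series_unique _ _ (is_series_geom (w ^ 2) (H2 w Hw))).
    symmetry; apply is_series_unique.
    apply is_series_ext_R with (2 := is_series_plus_R _ _ _ _
      (bounded_power_series a _ Rabs_inv_odd (H2 w Hw)) (is_series_scal_R 2 _ _ H)).
    intros n; unfold a; assert (Hn := pos_INR n); field; lra. }
  apply (is_derive_ext (fun w => minus (w * PSeries a (w ^ 2)) (arth w))); [reflexivity|].
  replace 0 with (minus (PSeries a (w ^ 2) + 2 * (w ^ 2 * d)) (/ (1 - w ^ 2))).
  2: { rewrite E; unfold minus, plus, opp; simpl; ring. }
  apply (is_derive_minus (fun w => w * PSeries a (w ^ 2)) arth); [|apply is_derive_arth; lra].
  auto_derive.
  - exists d; exact Hd.
  - replace (Derive (fun x : R => PSeries a x) (w * (w * 1))) with d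
      by (symmetry; apply is_derive_unique, Hd).
    simpl; ring. }
replace (arth r / r) with (PSeries a (r ^ 2)).
- apply (bounded_power_series a); [apply Rabs_inv_odd | apply H2; lra].
- assert (E := eq_is_derive (fun w => w * PSeries a (w ^ 2) - arth w) 0 r
    (fun t Ht => Hd t ltac:(lra)) (proj1 Hr)); simpl in E.
  assert (E0 : arth 0 = 0).
  { unfold arth; replace ((1 + 0) / (1 - 0)) with 1 by field; rewrite ln_1; ring. }
  rewrite E0 in E; apply Rmult_eq_reg_l with r; [|lra].
  replace (r * (arth r / r)) with (arth r) by (field; lra).
  simpl; lra.
Qed.

Lemma ex_series_Rabs_pow (a : nat -> R) (x : R) :
  (forall n, Rabs (a n) <= 1) -> 0 < x < 1 ->
  ex_series (fun n => Rabs (a n * x ^ n)).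
Proof.
intros Ha Hx.
apply (ex_series_le (V := R_CompleteNormedModule) _ (fun n => x ^ n)).
- intros n; unfold norm; simpl; unfold abs; simpl.
  rewrite Rabs_Rabsolu, Rabs_mult, (Rabs_pos_eq (x ^ n)) by (apply pow_le; lra).
  rewrite <- (Rmult_1_l (x ^ n)) at 2.
  apply Rmult_le_compat_r; [apply pow_le; lra | apply Ha].
- eexists; apply is_series_geom; rewrite Rabs_pos_eq; lra.
Qed.

Lemma power_series_mult (a b : nat -> R) (x A B : R) :
  (forall n, Rabs (a n) <= 1) -> (forall n, Rabs (b n) <= 1) -> 0 < x < 1 ->
  is_series (fun n => a n * x ^ n) A -> is_series (fun n => b n * x ^ n) B ->
  is_series (fun n => sum_f_R0 (fun j => a j * b (n - j)%nat) n * x ^ n) (A * B).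
Proof.
intros Ha Hb Hx HA HB.
apply is_series_ext_R with (2 := is_series_mult _ _ _ _ HA HB
  (ex_series_Rabs_pow a x Ha Hx) (ex_series_Rabs_pow b x Hb Hx)).
intros n; rewrite Rmult_comm, scal_sum; apply sum_eq; intros j Hj.
replace (x ^ n) with (x ^ j * x ^ (n - j)) by (rewrite <- pow_add; f_equal; lia).
ring.
Qed.

Lemma Rabs_kcoef (n : nat) : Rabs (kcoef n) <= 1.
Proof.
unfold kcoef; rewrite <- RPow_abs, <- (pow1 2); apply pow_incr.
split; [apply Rabs_pos | apply Rabs_cbinom].
Qed.

Lemma Rabs_ecoef (n : nat) : Rabs (ecoef n) <= 1.
Proof.
destruct n as [|n].
- unfold ecoef, kcoef; simpl; replace (_ / _) with 1 by field; rewrite Rabs_R1; lra.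
- rewrite ecoef_cbinom, Rabs_mult, <- (Rmult_1_l 1).
  apply Rmult_le_compat; [apply Rabs_pos | apply Rabs_pos | | apply Rabs_cbinom].
  apply (Rabs_sqrt_coef (S n)).
Qed.

Lemma arth_ellK_series (r : R) : 0 < r < 1 ->
  is_series (fun n => akcoef n * (r ^ 2) ^ n) (2 / PI * ellK r * (arth r / r)).
Proof.
intros Hr; apply (power_series_mult kcoef (fun n => / (2 * INR n + 1))).
- apply Rabs_kcoef.
- apply Rabs_inv_odd.
- nra.
- apply ellK_series, Hr.
- apply arth_series, Hr.
Qed.

Lemma arth_ellE_series (r : R) : 0 < r < 1 ->
  is_series (fun n => aecoef n * (r ^ 2) ^ n) (2 / PI * ellE r * (arth r / r)).
Proof.
intros Hr; apply (power_series_mult ecoef (fun n => / (2 * INR n + 1))).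
- apply Rabs_ecoef.
- apply Rabs_inv_odd.
- nra.
- apply ellE_series, Hr.
- apply arth_series, Hr.
Qed.

(** * Signs of the coefficients *)

(* The coefficients grow like [kcoef n * ln n]; these rational bounds are
   propagated by [akcoef_S] and suffice for every sign below. *)
Lemma akcoef_ge (n : nat) :
  (2 * INR n + 1) * kcoef n <= (INR n + 1) * akcoef n.
Proof.
induction n as [|n IH].
- unfold akcoef, kcoef; simpl; lra.
- rewrite akcoef_S, kcoef_S, S_INR.
  assert (Hk := kcoef_pos n); assert (Hm := pos_INR n).
  set (m := INR n) in *; set (k := kcoef n) in *; set (u := akcoef n) in *.
  clearbody m k u.
  apply Rminus_le_0.
  (* The induction hypothesis enters with a positive factor, and the remaining polynomial has only
     positive coefficients. The sign lemmas below are certified in the same way. *)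
  replace (_ - _) with
    ((16 * (m + 2) * (m + 1) ^ 3 * ((m + 1) * u - (2 * m + 1) * k)
      + (16 * m ^ 4 + 68 * m ^ 3 + 104 * m ^ 2 + 67 * m + 15) * k)
     / (4 * (m + 1) ^ 2 * (2 * m + 3) ^ 2)) by (field; lra).
  apply Rdiv_le_0_compat.
  + apply Rplus_le_le_0_compat.
    * apply Rmult_le_pos; [|lra].
      repeat (apply Rmult_le_pos || apply pow_le || lra).
    * repeat (apply Rplus_le_le_0_compat || apply Rmult_le_pos || apply pow_le || lra).
  + repeat (apply Rmult_lt_0_compat || apply pow_lt || lra).
Qed.

(** An equality at n = 0, as it has to be: [f21coef 0] vanishes and leaves no slack there. For large
    n the bound may be crude, being linear in n where the ratio grows logarithmically. *)
Lemma akcoef_le (n : nat) :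
  4 * (INR n + 1) * akcoef n <= (3 * INR n ^ 2 + 12 * INR n + 4) * kcoef n.
Proof.
induction n as [|n IH].
- unfold akcoef, kcoef; simpl; lra.
- rewrite akcoef_S, kcoef_S, S_INR.
  assert (Hk := kcoef_pos n); assert (Hm := pos_INR n).
  set (m := INR n) in *; set (k := kcoef n) in *; set (u := akcoef n) in *.
  clearbody m k u.
  apply Rminus_le_0.
  replace (_ - _) with
    ((16 * (m + 2) * (m + 1) ^ 3 * ((3 * m ^ 2 + 12 * m + 4) * k - 4 * (m + 1) * u)
      + (48 * m ^ 5 + 200 * m ^ 4 + 288 * m ^ 3 + 163 * m ^ 2
  + 30 * m + 3) * k)
     / (4 * (m + 1) ^ 2 * (2 * m + 3) ^ 2)) by (field; lra).
  apply Rdiv_le_0_compat.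
  + apply Rplus_le_le_0_compat.
    * apply Rmult_le_pos; [|lra].
      repeat (apply Rmult_le_pos || apply pow_le || lra).
    * repeat (apply Rplus_le_le_0_compat || apply Rmult_le_pos || apply pow_le || lra).
  + repeat (apply Rmult_lt_0_compat || apply pow_lt || lra).
Qed.

(** Coefficients of 2/PI (r - (1 - r^2) arth r) K / r^3. The shift is possible because K and K arth
    r / r have the same constant term. *)
Definition xkcoef (n : nat) : R := kcoef (S n) - akcoef (S n) + akcoef n.

Definition f20coef (n : nat) : R :=
  3 / 4 * xkcoef (S n) + 1 / 4 * xkcoef n
  - (aecoef (S (S n)) - akcoef (S (S n)) + akcoef (S n)).

Definition f21coef (n : nat) : R :=
  (aecoef (S (S n)) - akcoef (S (S n)) + akcoef (S n))
  - 3 / 4 * xkcoef (S n) - 1 / 160 * xkcoef n.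

(** Coefficient of index n + 2 of 2/PI (r - (1 - r^2) arth r) E / r. The term of index 1 is 2/3: in
    [f22] it cancels against the other summand, in [f23] it is part of the value 4 PI / 3 at 0. *)
Definition xecoef (n : nat) : R :=
  ecoef (S (S n)) - aecoef (S (S n)) + aecoef (S n).

Definition f22coef (n : nat) : R :=
  xecoef n - 2 * (akcoef (S (S n)) - akcoef (S n) - kcoef (S (S n)) + kcoef (S n)).

(** Taken from [4 * PI / 3 - f23], so that the decreasing function also leads to positive
    coefficients. *)
Definition f23coef (n : nat) : R :=
  2 * (akcoef n - akcoef (S n)) - xecoef n.

(** The recursions eliminate all shifted terms, so every coefficient becomes a combination of k_n
    and u_n over the rational functions of n. *)
Ltac reduce_coef n :=
  rewrite ?aecoef_S; unfold ecoef; rewrite ?akcoef_S, ?kcoef_S, ?S_INR;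
  let H := fresh in assert (H := pos_INR n);
  set (m := INR n) in *; set (k := kcoef n); set (u := akcoef n);
  clearbody m k u; field; repeat split; nra || lra.

Lemma xkcoef_eq (n : nat) :
  xkcoef n = ((2 * INR n + 1) ^ 2 * kcoef n + (4 * INR n + 5) * akcoef n)
             / (2 * INR n + 3) ^ 2.
Proof. unfold xkcoef; reduce_coef n. Qed.

Lemma f20coef_eq (n : nat) (m := INR n) :
  f20coef n = (2 * (m + 1) * (m + 2) * (32 * m ^ 3 + 160 * m ^ 2 + 272 * m + 153) * akcoef n
    - (32 * m ^ 5 + 168 * m ^ 4 + 344 * m ^ 3 + 342 * m ^ 2 + 158 * m + 27) * kcoef n)
    / (8 * (m + 1) * (m + 2) * (2 * m + 3) ^ 2 * (2 * m + 5) ^ 2).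
Proof. subst m; unfold f20coef, xkcoef; reduce_coef n. Qed.

Lemma f21coef_eq (n : nat) (m := INR n) :
  f21coef n = ((624 * m ^ 6 + 6256 * m ^ 5 + 23016 * m ^ 4 + 40576 * m ^ 3
      + 36207 * m ^ 2 + 15445 * m + 2490) * kcoef n
    - (m + 1) * (m + 2) * (656 * m ^ 3 + 2500 * m ^ 2 + 3080 * m + 1245) * akcoef n)
    / (160 * (m + 1) * (m + 2) * (2 * m + 3) ^ 2 * (2 * m + 5) ^ 2).
Proof. subst m; unfold f21coef, xkcoef; reduce_coef n. Qed.

Lemma f22coef_eq (n : nat) (m := INR n) :
  f22coef n = ((m + 1) * (32 * m ^ 3 + 120 * m ^ 2 + 126 * m + 38) * akcoef n
    - (56 * m ^ 4 + 216 * m ^ 3 + 266 * m ^ 2 + 132 * m + 23) * kcoef n)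
    / ((m + 1) * (2 * m + 3) ^ 2 * (2 * m + 5) ^ 2).
Proof. subst m; unfold f22coef, xecoef; reduce_coef n. Qed.

Lemma f23coef_eq (n : nat) (m := INR n) :
  f23coef n = ((m + 1) ^ 2 * (32 * m ^ 3 + 216 * m ^ 2 + 450 * m + 284) * akcoef n
    - (40 * m ^ 5 + 312 * m ^ 4 + 846 * m ^ 3 + 988 * m ^ 2 + 497 * m + 89) * kcoef n)
    / ((m + 1) ^ 2 * (2 * m + 3) ^ 2 * (2 * m + 5) ^ 2).
Proof. subst m; unfold f23coef, xecoef; reduce_coef n. Qed.

(** The determinant whose sign decides how the coefficient quotients move. As a quadratic form in k
    and u it has a negative u^2 term, so an upper bound on u is indispensable; it is written as k^2,
    k times the slack of the lower bound, and u times the slack of the upper bound, with positive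
    polynomial weights. *)
Lemma f20coef_xkcoef_cross (n : nat) (m := INR n) (k := kcoef n) (u := akcoef n) :
  f20coef n * xkcoef (S n) - f20coef (S n) * xkcoef n =
  ((8192 * m ^ 13 + 174080 * m ^ 12 + 1713152 * m ^ 11 + 10325760 * m ^ 10
  + 42318080 * m ^ 9 + 123579520 * m ^ 8 + 262235680 * m ^ 7
  + 405884992 * m ^ 6 + 454711168 * m ^ 5 + 361855776 * m ^ 4
  + 197919424 * m ^ 3 + 70328624 * m ^ 2 + 14585991 * m + 1341900) * k ^ 2
   + (16384 * m ^ 12 + 336896 * m ^ 11 + 3155968 * m ^ 10 + 17756544 * m ^ 9
  + 66522688 * m ^ 8 + 173846816 * m ^ 7 + 323015744 * m ^ 6
  + 427384576 * m ^ 5 + 397377296 * m ^ 4 + 251914224 * m ^ 3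
  + 102938276 * m ^ 2 + 24313684 * m + 2526519) * k
     * ((m + 1) * u - (2 * m + 1) * k)
   + 8 * (m + 1) ^ 2 * (m + 2) * (m + 3)
     * (640 * m ^ 6 + 6656 * m ^ 5 + 27632 * m ^ 4 + 58760 * m ^ 3
  + 67700 * m ^ 2 + 40208 * m + 9652) * u
     * ((3 * m ^ 2 + 12 * m + 4) * k - 4 * (m + 1) * u))
  / (32 * (m + 1) ^ 3 * (m + 2) * (m + 3) * (2 * m + 3) ^ 4 * (2 * m + 5) ^ 4
     * (2 * m + 7) ^ 2).
Proof.
subst m k u; rewrite !f20coef_eq, !xkcoef_eq, akcoef_S, kcoef_S, S_INR.
assert (Hm := pos_INR n); set (m := INR n) in *; set (k := kcoef n); set (u := akcoef n); clearbody m k u.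
field; lra.
Qed.

Ltac nonneg :=
  repeat (lra || apply Rplus_le_le_0_compat || apply Rmult_le_pos || apply pow_le).

Ltac pos_denominator :=
  repeat (apply Rmult_lt_0_compat || apply pow_lt || lra).

Ltac coef_context n :=
  assert (Hlo := akcoef_ge n); assert (Hhi := akcoef_le n);
  assert (Hk := kcoef_pos n); assert (Hm := pos_INR n);
  set (m := INR n) in *; set (k := kcoef n) in *; set (u := akcoef n) in *;
  clearbody m k u.

Lemma akcoef_pos (n : nat) : 0 < akcoef n.
Proof.
coef_context n.
apply Rmult_lt_reg_l with (m + 1); [lra|].
rewrite Rmult_0_r; apply Rlt_le_trans with (2 := Hlo).
apply Rmult_lt_0_compat; lra.
Qed.

Lemma xkcoef_pos (n : nat) : 0 < xkcoef n.
Proof.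
rewrite xkcoef_eq; assert (Hu := akcoef_pos n); coef_context n.
apply Rdiv_lt_0_compat; pos_denominator.
apply Rplus_lt_0_compat; pos_denominator.
Qed.

Lemma f20coef_pos (n : nat) : 0 < f20coef n.
Proof.
rewrite f20coef_eq; coef_context n.
apply Rdiv_lt_0_compat; [|pos_denominator].
replace (_ - _) with
  (2 * (m + 2) * (32 * m ^ 3 + 160 * m ^ 2 + 272 * m + 153)
     * ((m + 1) * u - (2 * m + 1) * k)
   + (96 * m ^ 5 + 792 * m ^ 4 + 2472 * m ^ 3 + 3630 * m ^ 2 + 2460 * m + 585) * k) by ring.
apply Rplus_le_lt_0_compat; [nonneg|].
apply Rmult_lt_0_compat; [apply Rplus_le_lt_0_compat; [nonneg | lra] | exact Hk].
Qed.

(** The factor 4 matches the one in [akcoef_le]. The rest carries a factor m, so strict positivity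
    begins only at index 1. *)
Lemma f21coef_numerator (m k u : R) :
  4 * ((624 * m ^ 6 + 6256 * m ^ 5 + 23016 * m ^ 4 + 40576 * m ^ 3
      + 36207 * m ^ 2 + 15445 * m + 2490) * k
    - (m + 1) * (m + 2) * (656 * m ^ 3 + 2500 * m ^ 2 + 3080 * m + 1245) * u)
  = (m + 2) * (656 * m ^ 3 + 2500 * m ^ 2 + 3080 * m + 1245)
     * ((3 * m ^ 2 + 12 * m + 4) * k - 4 * (m + 1) * u)
   + m * (528 * m ^ 5 + 5716 * m ^ 4 + 19456 * m ^ 3 + 27881 * m ^ 2 + 16178 * m
  + 2280) * k.
Proof. ring. Qed.

Lemma f21coef_nonneg (n : nat) : 0 <= f21coef n.
Proof.
rewrite f21coef_eq; coef_context n.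
apply Rdiv_le_0_compat; [|pos_denominator].
apply Rmult_le_reg_l with 4; [lra|].
rewrite Rmult_0_r, f21coef_numerator; nonneg.
Qed.

Lemma f21coef_S_pos (n : nat) : 0 < f21coef (S n).
Proof.
rewrite f21coef_eq.
assert (Hn : 0 < INR (S n)) by (rewrite S_INR; assert (H := pos_INR n); lra).
coef_context (S n).
apply Rdiv_lt_0_compat; [|pos_denominator].
apply Rmult_lt_reg_l with 4; [lra|].
rewrite Rmult_0_r, f21coef_numerator.
apply Rplus_le_lt_0_compat; [nonneg|].
apply Rmult_lt_0_compat; [apply Rmult_lt_0_compat; [exact Hn|] | exact Hk].
apply Rplus_le_lt_0_compat; [nonneg | lra].
Qed.

Lemma f22coef_pos (n : nat) : 0 < f22coef n.
Proof.
rewrite f22coef_eq; coef_context n.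
apply Rdiv_lt_0_compat; [|pos_denominator].
replace (_ - _) with
  ((32 * m ^ 3 + 120 * m ^ 2 + 126 * m + 38) * ((m + 1) * u - (2 * m + 1) * k)
   + (8 * m ^ 4 + 56 * m ^ 3 + 106 * m ^ 2 + 70 * m + 15) * k) by ring.
apply Rplus_le_lt_0_compat; [nonneg|].
apply Rmult_lt_0_compat; [apply Rplus_le_lt_0_compat; [nonneg | lra] | exact Hk].
Qed.

Lemma f23coef_pos (n : nat) : 0 < f23coef n.
Proof.
rewrite f23coef_eq; coef_context n.
apply Rdiv_lt_0_compat; [|pos_denominator].
replace (_ - _) with
  ((m + 1) * (32 * m ^ 3 + 216 * m ^ 2 + 450 * m + 284)
     * ((m + 1) * u - (2 * m + 1) * k)
   + (24 * m ^ 5 + 216 * m ^ 4 + 734 * m ^ 3 + 1146 * m ^ 2 + 805 * m + 195) * k) by ring.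
apply Rplus_le_lt_0_compat; [nonneg|].
apply Rmult_lt_0_compat; [apply Rplus_le_lt_0_compat; [nonneg | lra] | exact Hk].
Qed.

Lemma f20coef_xkcoef_decreasing (n : nat) :
  f20coef (S n) * xkcoef n < f20coef n * xkcoef (S n).
Proof.
apply Rminus_lt_0; rewrite f20coef_xkcoef_cross.
assert (Hu := akcoef_pos n); coef_context n.
apply Rdiv_lt_0_compat; [|pos_denominator].
apply Rplus_lt_le_0_compat; [|nonneg].
apply Rplus_lt_le_0_compat; [|nonneg].
apply Rmult_lt_0_compat; [|apply pow_lt, Hk].
apply Rplus_le_lt_0_compat; [nonneg | lra].
Qed.

(** * Series for the functions of the theorem *)

Lemma even_power_series (a : nat -> R) (p : nat) (r g : R) : 0 < r ->
  is_series (fun n => a n * (r ^ 2) ^ n) (2 / PI * (g / r ^ p)) ->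
  is_series (fun n => PI / 2 * a n * r ^ (2 * n + p)) g.
Proof.
intros Hr H; assert (HPI := PI_RGT_0); assert (Hp := pow_lt r p Hr).
replace g with (PI / 2 * r ^ p * (2 / PI * (g / r ^ p))) by (field; lra).
apply is_series_ext_R with (2 := is_series_scal_R (PI / 2 * r ^ p) _ _ H).
intros n; rewrite <- pow_mult, pow_add; ring.
Qed.

Lemma xk_series (r : R) : 0 < r < 1 ->
  is_series (fun n => xkcoef n * (r ^ 2) ^ n)
    (2 / PI * ((r - (1 - r ^ 2) * arth r) * ellK r / r ^ 3)).
Proof.
intros Hr; assert (HPI := PI_RGT_0).
assert (Hx : r ^ 2 <> 0) by nra.
assert (HK := ellK_series r Hr); assert (HU := arth_ellK_series r Hr).
replace (2 / PI * _) with
  ((2 / PI * ellK r - kcoef 0) / r ^ 2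
   - (2 / PI * ellK r * (arth r / r) - akcoef 0) / r ^ 2
   + 2 / PI * ellK r * (arth r / r)).
- apply is_series_ext_R with (2 := is_series_plus_R _ _ _ _ (is_series_minus_R _ _ _ _
    (is_series_shift _ _ _ Hx HK) (is_series_shift _ _ _ Hx HU)) HU).
  intros n; unfold xkcoef; ring.
- unfold akcoef, kcoef; simpl; field; lra.
Qed.

Lemma coef_1 : kcoef 1 = 1 / 4 /\ akcoef 1 = 7 / 12 /\ aecoef 1 = 1 / 12
  /\ akcoef 0 = 1 /\ aecoef 0 = 1 /\ ecoef 0 = 1 /\ ecoef 1 = -1 / 4 /\ kcoef 0 = 1.
Proof.
unfold aecoef, akcoef, ecoef, kcoef; simpl; repeat split; field.
Qed.

Ltac coef_values :=
  destruct coef_1 as (? & ? & ? & ? & ? & ? & ? & ?);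
  repeat match goal with E : _ 1%nat = _ |- _ => rewrite E; clear E
    | E : _ 0%nat = _ |- _ => rewrite E; clear E end.

Lemma f20_series (r : R) : 0 < r < 1 ->
  is_series (fun n => f20coef n * (r ^ 2) ^ n) (2 / PI * (f20 r / r ^ 5)).
Proof.
intros Hr; assert (HPI := PI_RGT_0).
assert (Hx : r ^ 2 <> 0) by nra.
assert (HX := xk_series r Hr); assert (HX1 := is_series_shift _ _ _ Hx HX).
assert (HU1 := is_series_shift _ _ _ Hx (arth_ellK_series r Hr)).
assert (HU2 := is_series_shift _ _ _ Hx HU1).
assert (HV2 := is_series_shift _ _ _ Hx (is_series_shift _ _ _ Hx (arth_ellE_series r Hr))).
assert (H := is_series_minus_R _ _ _ _ (is_series_plus_R _ _ _ _
  (is_series_scal_R (3 / 4) _ _ HX1) (is_series_scal_R (1 / 4) _ _ HX))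
  (is_series_plus_R _ _ _ _ (is_series_minus_R _ _ _ _ HV2 HU2) HU1)).
match type of H with is_series _ ?v => replace (2 / PI * _) with v end.
- apply is_series_ext_R with (2 := H); intros n; unfold f20coef; ring.
- unfold f20, xkcoef; coef_values; field; lra.
Qed.

(** Here 39/160 = 1/4 - 1/160: adding [f20] and [f21] cancels all but this multiple of r^2 (r - (1 -
    r^2) arth r) K. *)
Lemma f21_series (r : R) : 0 < r < 1 ->
  is_series (fun n => f21coef n * (r ^ 2) ^ n) (2 / PI * (f21 r / r ^ 5)).
Proof.
intros Hr; assert (HPI := PI_RGT_0).
replace (2 / PI * _) with
  (39 / 160 * (2 / PI * ((r - (1 - r ^ 2) * arth r) * ellK r / r ^ 3))
   - 2 / PI * (f20 r / r ^ 5)) by (unfold f20, f21; field; lra).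
apply is_series_ext_R with (2 := is_series_minus_R _ _ _ _
  (is_series_scal_R (39 / 160) _ _ (xk_series r Hr)) (f20_series r Hr)).
intros n; unfold f20coef, f21coef; field.
Qed.

Lemma f22_series (r : R) : 0 < r < 1 ->
  is_series (fun n => f22coef n * (r ^ 2) ^ n) (2 / PI * (f22 r / r ^ 0)).
Proof.
intros Hr; assert (HPI := PI_RGT_0).
assert (Hx : r ^ 2 <> 0) by nra.
assert (HU1 := is_series_shift _ _ _ Hx (arth_ellK_series r Hr)).
assert (HU2 := is_series_shift _ _ _ Hx HU1).
assert (HV1 := is_series_shift _ _ _ Hx (arth_ellE_series r Hr)).
assert (HV2 := is_series_shift _ _ _ Hx HV1).
assert (HK1 := is_series_shift _ _ _ Hx (ellK_series r Hr)).
assert (HK2 := is_series_shift _ _ _ Hx HK1).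
assert (HE2 := is_series_shift _ _ _ Hx (is_series_shift _ _ _ Hx (ellE_series r Hr))).
assert (H := is_series_minus_R _ _ _ _
  (is_series_plus_R _ _ _ _ (is_series_minus_R _ _ _ _ HE2 HV2) HV1)
  (is_series_scal_R 2 _ _ (is_series_plus_R _ _ _ _ (is_series_minus_R _ _ _ _
    (is_series_minus_R _ _ _ _ HU2 HU1) HK2) HK1))).
match type of H with is_series _ ?v => replace (2 / PI * _) with v end.
- apply is_series_ext_R with (2 := H); intros n; unfold f22coef, xecoef; ring.
- unfold f22; coef_values; field; lra.
Qed.

Lemma f23_series (r : R) : 0 < r < 1 ->
  is_series (fun n => f23coef n * (r ^ 2) ^ n)
    (2 / PI * ((4 * PI / 3 - f23 r) / r ^ 2)).
Proof.
intros Hr; assert (HPI := PI_RGT_0).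
assert (Hx : r ^ 2 <> 0) by nra.
assert (HU := arth_ellK_series r Hr).
assert (HU1 := is_series_shift _ _ _ Hx HU).
assert (HV1 := is_series_shift _ _ _ Hx (arth_ellE_series r Hr)).
assert (HV2 := is_series_shift _ _ _ Hx HV1).
assert (HE2 := is_series_shift _ _ _ Hx (is_series_shift _ _ _ Hx (ellE_series r Hr))).
assert (H := is_series_minus_R _ _ _ _
  (is_series_scal_R 2 _ _ (is_series_minus_R _ _ _ _ HU HU1))
  (is_series_plus_R _ _ _ _ (is_series_minus_R _ _ _ _ HE2 HV2) HV1)).
match type of H with is_series _ ?v => replace (2 / PI * _) with v end.
- apply is_series_ext_R with (2 := H); intros n; unfold f23coef, xecoef; ring.
- unfold f23; coef_values; field; lra.
Qed.

(** * Continuity on (0, 1) and limits at 0 from series in even powers *)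

Lemma even_series_sqrt (a : nat -> R) (p : nat) (f : R -> R) (z : R) :
  (forall r, 0 < r < 1 -> is_series (fun n => a n * r ^ (2 * n + p)) (f r)) ->
  0 < z < 1 ->
  is_series (fun n => a n * z ^ n) (f (sqrt z) / sqrt z ^ p).
Proof.
intros f_series Hz.
assert (Hs : 0 < sqrt z < 1).
{ split; [apply sqrt_lt_R0; lra | rewrite <- sqrt_1; apply sqrt_lt_1; lra]. }
assert (Hp := pow_lt _ p (proj1 Hs)).
replace (f (sqrt z) / sqrt z ^ p) with (/ sqrt z ^ p * f (sqrt z)) by (field; lra).
apply is_series_ext_R with (2 := is_series_scal_R _ _ _ (f_series _ Hs)).
intros n; rewrite pow_add, pow_mult, pow2_sqrt by lra; field; lra.
Qed.

Lemma even_series_PSeries (a : nat -> R) (p : nat) (f : R -> R) (r : R) :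
  (forall r, 0 < r < 1 -> is_series (fun n => a n * r ^ (2 * n + p)) (f r)) ->
  0 < r < 1 -> f r = r ^ p * PSeries a (r ^ 2).
Proof.
intros f_series Hr; assert (Hp := pow_lt _ p (proj1 Hr)).
assert (H : PSeries a (r ^ 2) = f r / r ^ p).
{ assert (T := even_series_sqrt a p f (r ^ 2) f_series ltac:(nra)).
  rewrite sqrt_pow2 in T by lra; apply is_series_unique, T. }
rewrite H; field; lra.
Qed.

(** The series continues f across 0, which turns the right limit at 0 into a value. *)
Lemma even_series_PSeries_continuity (a : nat -> R) (p : nat) (f : R -> R) (r : R) :
  (forall r, 0 < r < 1 -> is_series (fun n => a n * r ^ (2 * n + p)) (f r)) ->
  -1 < r < 1 ->
  continuity_pt (fun r => r ^ p * PSeries a (r ^ 2)) r.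
Proof.
intros f_series Hr; apply continuity_pt_mult.
- apply derivable_continuous_pt, derivable_pt_pow.
- apply (continuity_pt_comp (fun r => r ^ 2) (PSeries a)).
  + apply derivable_continuous_pt, derivable_pt_pow.
  + apply (PSeries_continuity_1 a _ _ (fun z => even_series_sqrt a p f z f_series)).
    rewrite Rabs_pos_eq; nra.
Qed.

Lemma even_series_continuity (a : nat -> R) (p : nat) (f : R -> R) (r : R) :
  (forall r, 0 < r < 1 -> is_series (fun n => a n * r ^ (2 * n + p)) (f r)) ->
  0 < r < 1 -> continuity_pt f r.
Proof.
intros f_series Hr; apply continuity_pt_ext_loc with
  (2 := even_series_PSeries_continuity a p f r f_series ltac:(lra)).
assert (H := filter_and _ _ (open_gt 0 r (proj1 Hr)) (open_lt 1 r (proj2 Hr))).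
apply filter_imp with (2 := H); intros z Hz; symmetry; apply (even_series_PSeries a p f _ f_series Hz).
Qed.

(** Since [0 ^ 0] is 1, the one formula gives [a 0] for p = 0 and 0 for p > 0. *)
Lemma even_series_at_0 (a : nat -> R) (p : nat) (f : R -> R) :
  (forall r, 0 < r < 1 -> is_series (fun n => a n * r ^ (2 * n + p)) (f r)) ->
  filterlim f (at_right 0) (locally (0 ^ p * a O)).
Proof.
intros f_series.
assert (H := proj1 (continuity_pt_filterlim _ _) 
  (even_series_PSeries_continuity a p f 0 f_series ltac:(lra))).
replace (0 ^ p * a 0%nat) with (0 ^ p * PSeries a (0 ^ 2)).
2: { replace (0 ^ 2) with 0 by ring; rewrite PSeries_0; reflexivity. }
apply filterlim_ext_loc with (f := fun r => r ^ p * PSeries a (r ^ 2)).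
- exists (mkposreal 1 Rlt_0_1); intros z Hz Hz0.
  apply Rabs_def2 in Hz; unfold minus, plus, opp in Hz; simpl in Hz.
  symmetry; apply (even_series_PSeries a p f _ f_series); lra.
- intros P HP; apply filter_le_within, H, HP.
Qed.

(** * Behaviour at 1 *)

Lemma is_RInt_sin : is_RInt sin 0 (PI / 2) 1.
Proof.
replace 1 with (minus (- cos (PI / 2)) (- cos 0)).
2: { rewrite cos_PI2, cos_0; unfold minus, plus, opp; simpl; ring. }
apply (is_RInt_derive (fun t => - cos t)); intros t _.
- auto_derive; [exact I | ring].
- apply continuous_sin.
Qed.

Lemma is_RInt_cos : is_RInt cos 0 (PI / 2) 1.
Proof.
replace 1 with (minus (sin (PI / 2)) (sin 0)).
2: { rewrite sin_PI2, sin_0; unfold minus, plus, opp; simpl; ring. }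
apply (is_RInt_derive sin); intros t _.
- apply is_derive_sin.
- apply continuous_cos.
Qed.

Lemma is_RInt_cos_div_1_sin :
  is_RInt (fun t => cos t / (1 + sin t)) 0 (PI / 2) (ln 2).
Proof.
assert (HPI := PI_RGT_0).
assert (Hs : forall t, Rmin 0 (PI / 2) <= t <= Rmax 0 (PI / 2) -> 0 < 1 + sin t).
{ rewrite Rmin_left, Rmax_right by lra; intros t Ht.
  assert (0 <= sin t) by (apply sin_ge_0; lra); lra. }
replace (ln 2) with (minus (ln (1 + sin (PI / 2))) (ln (1 + sin 0))).
2: { rewrite sin_PI2, sin_0, Rplus_0_r, ln_1; replace (1 + 1) with 2 by ring.
     unfold minus, plus, opp; simpl; ring. }
apply (is_RInt_derive (fun t => ln (1 + sin t))); intros t Ht; specialize (Hs t Ht).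
- auto_derive; [exact Hs | field; lra].
- apply (ex_derive_continuous (V := R_NormedModule)); auto_derive; lra.
Qed.

Lemma arth_over_r_integral (r : R) : 0 < r < 1 ->
  is_RInt (fun t => sin t / sqrt (1 - r ^ 2 * sin t ^ 2)) 0 (PI / 2) (arth r / r).
Proof.
intros Hr; assert (HPI := PI_RGT_0).
(* Antiderivative found with c = cos t, which turns the integrand into - dc / sqrt (1 - r^2 + r^2
   c^2). *)
pose (F := fun t => - / r * ln (r * cos t + sqrt (1 - r ^ 2 * sin t ^ 2))).
assert (Hd : 0 < sqrt (1 - r ^ 2)) by (apply sqrt_lt_R0; nra).
replace (arth r / r) with (minus (F (PI / 2)) (F 0)).
2: { unfold F, arth; rewrite cos_PI2, sin_PI2, cos_0, sin_0.
     replace (1 - r ^ 2 * 1 ^ 2) with (1 - r ^ 2) by ring.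
     replace (1 - r ^ 2 * 0 ^ 2) with 1 by ring.
     rewrite sqrt_1, Rmult_0_r, Rplus_0_l, Rmult_1_r.
     assert (E : ln (1 - r ^ 2) = ln (sqrt (1 - r ^ 2)) + ln (sqrt (1 - r ^ 2))).
     { rewrite <- ln_mult, sqrt_sqrt by nra; reflexivity. }
     replace (1 - r ^ 2) with ((1 + r) * (1 - r)) in E at 1 by ring.
     rewrite ln_mult in E by lra; rewrite ln_div by lra.
     replace (ln (1 - r)) with (2 * ln (sqrt (1 - r ^ 2)) - ln (1 + r)) by lra.
     rewrite (Rplus_comm r 1).
     unfold minus, plus, opp; simpl; field; lra. }
assert (Hq : forall t, 0 < sqrt (1 - r ^ 2 * sin t ^ 2)).
{ intros t; apply sqrt_lt_R0, ell_radicand_pos, Hr. }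
apply (is_RInt_derive F); intros t Ht.
- rewrite Rmin_left, Rmax_right in Ht by lra.
  assert (Hc : 0 <= cos t) by (apply cos_ge_0; lra).
  assert (Hp := ell_radicand_pos r t Hr); specialize (Hq t).
  assert (Hrc : 0 <= r * cos t) by nra.
  unfold F; auto_derive.
  + replace (1 + - (r * (r * 1) * (sin t * (sin t * 1)))) with (1 - r ^ 2 * sin t ^ 2) by ring.
    repeat split; lra.
  + replace (1 + - (r * (r * 1) * (sin t * (sin t * 1)))) with (1 - r ^ 2 * sin t ^ 2) by ring.
    field; lra.
- apply (ex_derive_continuous (V := R_NormedModule)).
  assert (Hp := ell_radicand_pos r t Hr); specialize (Hq t).
  auto_derive.
  replace (1 + - (r * (r * 1) * (sin t * (sin t * 1)))) with (1 - r ^ 2 * sin t ^ 2) by ring.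
  repeat split; lra.
Qed.

(** The root is the hypotenuse of a right triangle with legs cos t and sqrt (1 - r^2) sin t, so it
    lies between one leg and the sum of both. *)
Lemma ell_radicand_bounds (r t : R) : 0 < r < 1 -> 0 <= sin t -> 0 <= cos t ->
  cos t <= sqrt (1 - r ^ 2 * sin t ^ 2) <= cos t + sqrt (1 - r ^ 2) * sin t.
Proof.
intros Hr Hs Hc.
assert (E := sin2_cos2 t); unfold Rsqr in E.
assert (Hd := sqrt_pos (1 - r ^ 2)).
assert (Hd2 : sqrt (1 - r ^ 2) * sqrt (1 - r ^ 2) = 1 - r ^ 2) by (apply sqrt_sqrt; nra).
set (d := sqrt (1 - r ^ 2)) in *.
assert (Er : 1 - r ^ 2 * sin t ^ 2 = cos t * cos t + d * d * (sin t * sin t)).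
{ rewrite Hd2; replace (cos t * cos t) with (1 - sin t * sin t) by lra; ring. }
assert (Hds : 0 <= d * sin t) by (apply Rmult_le_pos; assumption).
rewrite Er; split.
- rewrite <- (sqrt_square (cos t)) at 1 by exact Hc; apply sqrt_le_1_alt.
  assert (0 <= d * sin t * (d * sin t)) by (apply Rmult_le_pos; assumption); nra.
- rewrite <- (sqrt_square (cos t + d * sin t)) by lra; apply sqrt_le_1_alt.
  assert (0 <= cos t * (d * sin t)) by (apply Rmult_le_pos; assumption); nra.
Qed.

Lemma ellE_bounds (r : R) : 0 < r < 1 -> 1 <= ellE r <= 1 + sqrt (1 - r ^ 2).
Proof.
intros Hr; assert (HPI := PI_RGT_0).
assert (HE := RInt_correct (V := R_CompleteNormedModule) _ _ _ (ex_RInt_ellE r Hr)).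
fold (ellE r) in HE.
assert (Hb : forall t, 0 < t < PI / 2 ->
  cos t <= sqrt (1 - r ^ 2 * sin t ^ 2) <= cos t + sqrt (1 - r ^ 2) * sin t).
{ intros t Ht; apply ell_radicand_bounds; [exact Hr | apply sin_ge_0; lra | apply cos_ge_0; lra]. }
split.
- apply (is_RInt_le _ _ 0 (PI / 2) _ _ ltac:(lra) is_RInt_cos HE).
  intros t Ht; apply (Hb t Ht).
- assert (H := is_RInt_plus _ _ _ _ _ _ is_RInt_cos
    (is_RInt_scal _ _ _ (sqrt (1 - r ^ 2)) _ is_RInt_sin)).
  replace (1 + sqrt (1 - r ^ 2)) with (plus 1 (scal (sqrt (1 - r ^ 2)) 1)).
  2: { unfold plus, scal; simpl; unfold mult; simpl; ring. }
  apply (is_RInt_le _ _ 0 (PI / 2) _ _ ltac:(lra) HE H).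
  intros t Ht; apply (Hb t Ht).
Qed.

(* [ellK r - arth r / r] is the integral of [(1 - sin) / sqrt (1 - r^2 sin^2)],
   which tends uniformly to [(1 - sin) / cos = cos / (1 + sin)]. *)
Lemma ellK_minus_arth_bounds (r : R) : 0 < r < 1 ->
  ln 2 - PI / 2 * sqrt (1 - r ^ 2) <= ellK r - arth r / r <= ln 2.
Proof.
intros Hr; assert (HPI := PI_RGT_0).
assert (HK := RInt_correct (V := R_CompleteNormedModule) _ _ _ (ex_RInt_ellK r Hr)).
fold (ellK r) in HK.
assert (HD := is_RInt_minus _ _ _ _ _ _ HK (arth_over_r_integral r Hr)).
assert (Hd := sqrt_pos (1 - r ^ 2)).
assert (Hb : forall t, 0 < t < PI / 2 ->
  cos t / (1 + sin t) - sqrt (1 - r ^ 2)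
    <= / sqrt (1 - r ^ 2 * sin t ^ 2) - sin t / sqrt (1 - r ^ 2 * sin t ^ 2)
    <= cos t / (1 + sin t)).
{ intros t Ht.
  assert (Hs : 0 < sin t) by (apply sin_gt_0; lra).
  assert (Hc : 0 < cos t) by (apply cos_gt_0; lra).
  assert (E := sin2_cos2 t); unfold Rsqr in E.
  destruct (ell_radicand_bounds r t Hr (Rlt_le _ _ Hs) (Rlt_le _ _ Hc)) as [H1 H2].
  set (q := sqrt (1 - r ^ 2 * sin t ^ 2)) in *; set (d := sqrt (1 - r ^ 2)) in *.
  set (s := sin t) in *; set (c := cos t) in *; clearbody q d s c.
  assert (Hs1 : s < 1) by nra.
  replace (c / (1 + s)) with ((1 - s) / c).
  2: { apply Rmult_eq_reg_r with (c * (1 + s)); [field_simplify; try lra; nra | nra]. }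
  replace (/ q - s / q) with ((1 - s) / q) by (field; lra).
  assert (Hdiff : (1 - s) / c - (1 - s) / q = (1 - s) * (q - c) / (c * q)) by (field; lra).
  assert (Hqc : 0 < c * q) by nra.
  split.
  - assert ((1 - s) * (q - c) / (c * q) <= d); [|lra].
    apply Rle_div_l; [exact Hqc|].
    (* Here q - c <= d s <= d, and c q >= c^2 = (1 - s)(1 + s) >= 1 - s; hence the quotient is at
       most d, uniformly in t. *)
    assert (T1 : (1 - s) * (q - c) <= (1 - s) * d).
    { apply Rmult_le_compat_l; [lra|]; nra. }
    assert (T2 : d * (1 - s) <= d * (c * q)).
    { apply Rmult_le_compat_l; [exact Hd|]; nra. }
    lra.
  - assert (0 <= (1 - s) * (q - c) / (c * q)); [|lra].
    apply Rdiv_le_0_compat; [nra | exact Hqc]. }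
split.
- assert (HL := is_RInt_minus _ _ _ _ _ _ is_RInt_cos_div_1_sin
    (is_RInt_const (V := R_NormedModule) 0 (PI / 2) (sqrt (1 - r ^ 2)))).
  replace (ln 2 - PI / 2 * sqrt (1 - r ^ 2)) with
    (minus (ln 2) (scal (PI / 2 - 0) (sqrt (1 - r ^ 2)))).
  2: { unfold minus, plus, opp, scal; simpl; unfold mult; simpl; ring. }
  apply (is_RInt_le _ _ 0 (PI / 2) _ _ ltac:(lra) HL HD).
  intros t Ht; apply (Hb t Ht).
- apply (is_RInt_le _ _ 0 (PI / 2) _ _ ltac:(lra) HD is_RInt_cos_div_1_sin).
  intros t Ht; apply (Hb t Ht).
Qed.

Lemma arth_nonneg (r : R) : 0 < r < 1 -> 0 <= arth r.
Proof.
intros Hr; unfold arth.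
apply Rmult_le_pos; [lra|]; rewrite <- ln_1; apply ln_le; [lra|].
apply Rle_div_r; lra.
Qed.

(** A fourth root beats the logarithm: with w = (1 + r)/(1 - r) and q = w^(1/4), arth r = 2 ln q <=
    2 q. The fourth power of 2 q sqrt (1 - r^2) is 16 (1 + r)^3 (1 - r), at most 128 (1 - r). *)
Lemma sqrt_mul_arth_le (r : R) : 0 < r < 1 ->
  sqrt (1 - r ^ 2) * arth r <= sqrt (sqrt (128 * (1 - r))).
Proof.
intros Hr; set (w := (1 + r) / (1 - r)).
assert (Hw : 0 < w) by (apply Rdiv_lt_0_compat; lra).
set (q := sqrt (sqrt w)).
assert (Hq : 0 < q) by (apply sqrt_lt_R0, sqrt_lt_R0, Hw).
assert (Hq4 : q ^ 4 = w).
{ unfold q; replace 4%nat with (2 * 2)%nat by reflexivity.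
  rewrite pow_mult, !pow2_sqrt; [reflexivity | lra | apply sqrt_pos]. }
assert (HA : arth r <= 2 * q).
{ unfold arth; fold w; rewrite <- Hq4.
  assert (Hln : ln q <= q).
  { apply Rlt_le; rewrite <- (ln_exp q) at 2; apply ln_increasing; [exact Hq|].
    assert (H := exp_ineq1 q ltac:(lra)); lra. }
  assert (Hln4 : ln (q ^ 4) = 4 * ln q) by (rewrite Rpower.ln_pow by exact Hq; simpl; ring).
  rewrite Hln4; lra. }
set (d := sqrt (1 - r ^ 2)).
assert (Hd : 0 <= d) by apply sqrt_pos.
assert (Hd2 : d ^ 2 = 1 - r ^ 2) by (apply pow2_sqrt; nra).
apply Rle_trans with (2 * d * q); [nra|].
rewrite <- (sqrt_pow2 (2 * d * q)) by nra.
apply sqrt_le_1_alt.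
rewrite <- (sqrt_pow2 ((2 * d * q) ^ 2)) by (apply pow_le; nra).
apply sqrt_le_1_alt.
replace (((2 * d * q) ^ 2) ^ 2) with (16 * (d ^ 2) ^ 2 * q ^ 4) by ring.
rewrite Hd2, Hq4; unfold w.
replace (16 * (1 - r ^ 2) ^ 2 * ((1 + r) / (1 - r))) with (16 * (1 + r) ^ 3 * (1 - r))
  by (field; lra).
apply Rmult_le_compat_r; [lra|].
assert (H8 : (1 + r) ^ 3 <= 2 ^ 3) by (apply pow_incr; lra); lra.
Qed.

(** * Calculus of limits from the left at 1 *)

Definition tends_at_1 (f : R -> R) (l : R) : Prop :=
  filterlim f (at_left 1) (locally l).

Lemma at_left_1 (b : R) : b < 1 -> at_left 1 (fun z => b < z < 1).
Proof.
intros Hb; assert (Hb' : 0 < 1 - b) by lra.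
exists (mkposreal _ Hb'); intros z Hz Hz0.
apply Rabs_def2 in Hz; unfold minus, plus, opp in Hz; simpl in Hz; lra.
Qed.

(** The separate equation [l = l'] allows the limit to be assembled by the rules below as an
    existential variable and simplified afterwards; hence the shelved goals further on. *)
Lemma tends_ext (f g : R -> R) (l l' : R) :
  (forall r, 0 < r < 1 -> f r = g r) -> l = l' -> tends_at_1 f l -> tends_at_1 g l'.
Proof.
intros H <-; apply filterlim_ext_loc.
apply filter_imp with (2 := at_left_1 0 Rlt_0_1); exact H.
Qed.

Lemma tends_const (c : R) : tends_at_1 (fun _ => c) c.
Proof. apply filterlim_const. Qed.

Lemma tends_continuous (f : R -> R) : continuity_pt f 1 -> tends_at_1 f (f 1).
Proof.
intros H P HP; apply filter_le_within.
apply (proj1 (continuity_pt_filterlim f 1) H P HP).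
Qed.

Lemma tends_plus (f g : R -> R) (l m : R) :
  tends_at_1 f l -> tends_at_1 g m -> tends_at_1 (fun r => f r + g r) (l + m).
Proof.
intros Hf Hg.
exact (filterlim_comp_2 f g plus Hf Hg (filterlim_plus (V := R_NormedModule) l m)).
Qed.

Lemma tends_mult (f g : R -> R) (l m : R) :
  tends_at_1 f l -> tends_at_1 g m -> tends_at_1 (fun r => f r * g r) (l * m).
Proof.
intros Hf Hg; exact (filterlim_comp_2 f g Rmult Hf Hg (filterlim_mult (K := R_AbsRing) l m)).
Qed.

Lemma tends_opp (f : R -> R) (l : R) :
  tends_at_1 f l -> tends_at_1 (fun r => - f r) (- l).
Proof.
intros Hf; exact (filterlim_comp _ _ _ f Ropp _ _ _ Hf (filterlim_opp (V := R_NormedModule) l)).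
Qed.

Lemma tends_minus (f g : R -> R) (l m : R) :
  tends_at_1 f l -> tends_at_1 g m -> tends_at_1 (fun r => f r - g r) (l - m).
Proof. intros Hf Hg; apply tends_plus; [exact Hf | apply tends_opp, Hg]. Qed.

Lemma tends_inv (f : R -> R) (l : R) :
  l <> 0 -> tends_at_1 f l -> tends_at_1 (fun r => / f r) (/ l).
Proof.
intros Hl Hf; apply (filterlim_comp _ _ _ f Rinv _ _ _ Hf).
apply (filterlim_Rbar_inv (Finite l)); intros H; apply Hl; injection H; trivial.
Qed.

Lemma tends_squeeze (f g h : R -> R) (l : R) :
  (forall r, 0 < r < 1 -> f r <= g r <= h r) ->
  tends_at_1 f l -> tends_at_1 h l -> tends_at_1 g l.
Proof.
intros H Hf Hh; apply (filterlim_le_le f g h (Finite l)); [|exact Hf | exact Hh].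
apply filter_imp with (2 := at_left_1 0 Rlt_0_1); exact H.
Qed.

Lemma tends_id : tends_at_1 (fun r => r) 1.
Proof. apply (tends_continuous (fun r => r)), continuity_pt_id. Qed.

Lemma tends_sqrt : tends_at_1 (fun r => sqrt (1 - r ^ 2)) 0.
Proof.
replace 0 with (sqrt (1 - 1 ^ 2)).
- apply (tends_continuous (fun r => sqrt (1 - r ^ 2))).
  apply (continuity_pt_comp (fun r => 1 - r ^ 2) sqrt).
  + apply derivable_continuous_pt; reg.
  + apply continuity_pt_sqrt; lra.
- replace (1 - 1 ^ 2) with 0 by ring; apply sqrt_0.
Qed.

Lemma tends_sqrt_arth : tends_at_1 (fun r => sqrt (1 - r ^ 2) * arth r) 0.
Proof.
apply tends_squeeze with (fun _ => 0) (fun r => sqrt (sqrt (128 * (1 - r)))).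
- intros r Hr; split; [|apply sqrt_mul_arth_le, Hr].
  apply Rmult_le_pos; [apply sqrt_pos | apply arth_nonneg, Hr].
- apply tends_const.
- replace 0 with (sqrt (sqrt (128 * (1 - 1)))).
  + apply (tends_continuous (fun r => sqrt (sqrt (128 * (1 - r))))).
    apply (continuity_pt_comp (fun r => sqrt (128 * (1 - r))) sqrt).
    * apply (continuity_pt_comp (fun r => 128 * (1 - r)) sqrt).
      -- apply derivable_continuous_pt; reg.
      -- apply continuity_pt_sqrt; lra.
    * apply continuity_pt_sqrt, sqrt_pos.
  + rewrite Rminus_diag, Rmult_0_r, sqrt_0; apply sqrt_0.
Qed.

Lemma tends_one_minus_arth : tends_at_1 (fun r => (1 - r) * arth r) 0.
Proof.
apply tends_squeeze with (fun _ => 0) (fun r => sqrt (1 - r ^ 2) * arth r).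
- intros r Hr; assert (HA := arth_nonneg r Hr); split; [apply Rmult_le_pos; lra|].
  apply Rmult_le_compat_r; [exact HA|].
  rewrite <- (sqrt_pow2 (1 - r)) at 1 by lra; apply sqrt_le_1_alt; nra.
- apply tends_const.
- apply tends_sqrt_arth.
Qed.

Lemma tends_ellE_arth : tends_at_1 (fun r => (ellE r - 1) * arth r) 0.
Proof.
apply tends_squeeze with (fun _ => 0) (fun r => sqrt (1 - r ^ 2) * arth r).
- intros r Hr; assert (HA := arth_nonneg r Hr); assert (HE := ellE_bounds r Hr).
  split; [apply Rmult_le_pos; lra | apply Rmult_le_compat_r; lra].
- apply tends_const.
- apply tends_sqrt_arth.
Qed.

Lemma tends_ellE : tends_at_1 ellE 1.
Proof.
apply tends_squeeze with (fun _ => 1) (fun r => 1 + sqrt (1 - r ^ 2)).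
- exact ellE_bounds.
- apply tends_const.
- apply (tends_ext (fun r => 1 + sqrt (1 - r ^ 2)) _ (1 + 0)); [reflexivity | ring |].
  apply tends_plus; [apply tends_const | apply tends_sqrt].
Qed.

(** Passing from arth r / r to arth r costs (1 - r) arth r / r, which tends to 0. *)
Lemma tends_ellK_minus_arth : tends_at_1 (fun r => ellK r - arth r) (ln 2).
Proof.
assert (H : tends_at_1 (fun r => ellK r - arth r / r) (ln 2)).
{ apply tends_squeeze with (fun r => ln 2 - PI / 2 * sqrt (1 - r ^ 2)) (fun _ => ln 2).
  - exact ellK_minus_arth_bounds.
  - apply (tends_ext (fun r => ln 2 - PI / 2 * sqrt (1 - r ^ 2)) _ (ln 2 - PI / 2 * 0));
      [reflexivity | ring |].
    apply tends_minus; [apply tends_const|].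
    apply tends_mult; [apply tends_const | apply tends_sqrt].
  - apply tends_const. }
eapply tends_ext; [| |exact (tends_plus _ _ _ _ H (tends_mult _ _ _ _
  tends_one_minus_arth (tends_inv _ _ R1_neq_R0 tends_id)))].
- intros r Hr; simpl; field; lra.
- field.
Qed.

Ltac tends_solve :=
  repeat first
    [ exact tends_sqrt | exact tends_sqrt_arth | exact tends_one_minus_arth
    | exact tends_ellE_arth | exact tends_ellE | exact tends_ellK_minus_arth
    | exact tends_id | apply tends_const
    | apply tends_minus | apply tends_plus | apply tends_mult ].

Lemma sqrt_one_minus_sqr (r : R) : 0 < r < 1 -> sqrt (1 - r ^ 2) ^ 2 = 1 - r ^ 2.
Proof. intros Hr; apply pow2_sqrt; nra. Qed.

(** Substitute K = D + arth r and 3/4 + r^2/4 = 1 - d^2/4. The divergent parts r arth r and arth r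
    combine to - (1 - r) arth r, and the terms d^2 (arth r)^2 of weight 1 cancel. All that remains
    is built from pieces with known limits, and only the first product, through D, contributes. *)
Lemma tends_f20 : tends_at_1 f20 (ln 2).
Proof.
pose (d := fun r => sqrt (1 - r ^ 2)).
pose (a := fun r => sqrt (1 - r ^ 2) * arth r).
pose (D := fun r => ellK r - arth r).
eapply (tends_ext (fun r => (1 - d r * d r * (1 / 4)) * (r - d r * a r) * D r + d r * a r * D r
  - (1 - r) * arth r - d r * a r * (1 / 4) * r + d r * d r * (1 / 4) * (a r * a r)
  - (ellE r - 1) * arth r)).
- intros r Hr; unfold d, a, D, f20.
  assert (E := sqrt_one_minus_sqr r Hr); set (q := sqrt (1 - r ^ 2)) in *; clearbody q.
  replace (r ^ 2) with (1 - q ^ 2) by lra; field.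
- shelve.
- unfold d, a, D; tends_solve.
Unshelve.
ring.
Qed.

Lemma tends_X : tends_at_1 (fun r => r - (1 - r ^ 2) * arth r) 1.
Proof.
eapply (tends_ext (fun r => r - sqrt (1 - r ^ 2) * (sqrt (1 - r ^ 2) * arth r))).
- intros r Hr; rewrite <- (sqrt_one_minus_sqr r Hr) at 3; ring.
- shelve.
- tends_solve.
Unshelve.
ring.
Qed.

Lemma tends_pow_inv (n : nat) : tends_at_1 (fun r => / r ^ n) 1.
Proof.
rewrite <- Rinv_1; apply tends_inv; [lra|].
induction n as [|n IH]; [apply tends_const|].
rewrite <- (Rmult_1_l 1); exact (tends_mult _ _ _ _ tends_id IH).
Qed.

(** Of the two factors sqrt (1 - r^2) in 1 - r^2, one tames [arth r - r] and the other tames K,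
    written as arth r plus a convergent difference. *)
Lemma tends_f22 : tends_at_1 f22 1.
Proof.
eapply (tends_ext (fun r => ((r - (1 - r ^ 2) * arth r) * ellE r
  - 2 * ((sqrt (1 - r ^ 2) * arth r - r * sqrt (1 - r ^ 2))
         * (sqrt (1 - r ^ 2) * arth r + sqrt (1 - r ^ 2) * (ellK r - arth r))))
  * / r ^ 5)).
- intros r Hr; unfold f22, Rdiv; f_equal; f_equal.
  replace (2 * (1 - r ^ 2)) with (2 * sqrt (1 - r ^ 2) ^ 2)
    by (rewrite (sqrt_one_minus_sqr r Hr); reflexivity).
  ring.
- shelve.
- apply tends_mult; [|apply tends_pow_inv].
  apply tends_minus; [apply tends_mult; [apply tends_X | apply tends_ellE]|].
  tends_solve.
Unshelve.
ring.
Qed.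

Lemma tends_f23 : tends_at_1 f23 1.
Proof.
eapply (tends_ext (fun r => 2 * ((sqrt (1 - r ^ 2) * arth r)
    * (sqrt (1 - r ^ 2) * arth r + sqrt (1 - r ^ 2) * (ellK r - arth r)) * / r ^ 1)
  + (r - (1 - r ^ 2) * arth r) * / r ^ 3 * ellE r)).
- intros r Hr; unfold f23, Rdiv; f_equal.
  rewrite pow_1.
  replace (2 * ((1 - r ^ 2) * arth r * / r)) with (2 * (sqrt (1 - r ^ 2) ^ 2 * arth r * / r))
    by (rewrite (sqrt_one_minus_sqr r Hr); reflexivity).
  ring.
- shelve.
- apply tends_plus.
  + apply tends_mult; [tends_solve|].
    apply tends_mult; [tends_solve | apply tends_pow_inv].
  + apply tends_mult; [|apply tends_ellE].
    apply tends_mult; [apply tends_X | apply tends_pow_inv].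
Unshelve.
ring.
Qed.

Lemma arth_large (M : R) : at_left 1 (fun r => M < arth r).
Proof.
apply filter_imp with (fun r => Rmax 0 (1 - exp (- (2 * M))) < r < 1).
- intros r [H1 H2].
  assert (H3 := Rle_lt_trans _ _ _ (Rmax_l _ _) H1).
  assert (H4 := Rle_lt_trans _ _ _ (Rmax_r _ _) H1).
  unfold arth; rewrite ln_div by lra.
  assert (H5 : 0 < ln (1 + r)) by (rewrite <- ln_1; apply ln_increasing; lra).
  assert (H6 : ln (1 - r) < - (2 * M)).
  { rewrite <- ln_exp; apply ln_increasing; lra. }
  lra.
- apply at_left_1, Rmax_lub_lt; [lra|].
  assert (H := exp_pos (- (2 * M))); lra.
Qed.

Lemma ellK_large (M : R) : at_left 1 (fun r => M < ellK r).
Proof.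
(* The margin 2 absorbs the error PI / 2 * sqrt (1 - r^2). *)
apply filter_imp with (2 := filter_and _ _ (arth_large (M + 2)) (at_left_1 0 Rlt_0_1)).
intros r [HM Hr]; cbv beta in Hr.
assert (HK := proj1 (ellK_minus_arth_bounds r Hr)).
assert (Hln : 0 < ln 2) by (rewrite <- ln_1; apply ln_increasing; lra).
assert (Hd : sqrt (1 - r ^ 2) <= sqrt 1) by (apply sqrt_le_1_alt; nra).
rewrite sqrt_1 in Hd.
assert (HPI := PI_4); assert (HPI' := PI_RGT_0).
assert (HA := arth_nonneg r Hr).
assert (Hq : arth r <= arth r / r).
{ assert (0 <= arth r * (1 - r)) by (apply Rmult_le_pos; lra).
  apply (Rle_div_r (arth r) (arth r) r); lra. }
assert (Hd0 := sqrt_pos (1 - r ^ 2)).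
nra.
Qed.

Lemma tends_inv_ellK : tends_at_1 (fun r => / ellK r) 0.
Proof.
apply (filterlim_comp _ _ _ ellK Rinv _ (Rbar_locally p_infty)).
- intros P [M HM]; apply filter_imp with (2 := ellK_large M); intros r Hr; apply HM, Hr.
- apply (filterlim_Rbar_inv p_infty); discriminate.
Qed.

Lemma f21_infty_at_1 : filterlim f21 (at_left 1) (Rbar_locally p_infty).
Proof.
intros P [M HM].
assert (H20 := tends_f20 _ (open_lt (ln 2 + 1) (ln 2) ltac:(lra))).
assert (HX := tends_mult _ _ _ _ (tends_mult _ _ _ _ tends_id tends_id) tends_X
  _ (open_gt (1 / 2) (1 * 1 * 1) ltac:(lra))).
unfold filtermap in H20, HX.
(* Near 1, [f20] stays below ln 2 + 1 and the factor of 39/160 K exceeds 1/2; the constant 320/39 is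
   2 * 160/39. *)
apply filter_imp with (2 := filter_and _ _ H20
  (filter_and _ _ HX (ellK_large (Rmax 0 ((M + ln 2 + 1) * (320 / 39)))))).
intros r [H1 [H2 H3]]; apply HM.
assert (H4 := Rle_lt_trans _ _ _ (Rmax_l _ _) H3).
assert (H5 := Rle_lt_trans _ _ _ (Rmax_r _ _) H3).
replace (f21 r) with (39 / 160 * (r * r * (r - (1 - r ^ 2) * arth r) * ellK r) - f20 r)
  by (unfold f20, f21; field).
assert (H6 : 1 / 2 * ellK r <= r * r * (r - (1 - r ^ 2) * arth r) * ellK r).
{ apply Rmult_le_compat_r; lra. }
lra.
Qed.

(** * The theorem *)

Lemma even_series_range (a : nat -> R) (p N : nat) (f : R -> R) (l : R) (L : Rbar) :
  (forall r, 0 < r < 1 -> is_series (fun n => a n * (r ^ 2) ^ n) (2 / PI * (f r / r ^ p))) ->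
  (forall n, 0 <= a n) -> (0 < 2 * N + p)%nat -> 0 < a N ->
  l = 0 ^ p * (PI / 2 * a 0%nat) ->
  filterlim f (at_left 1) (Rbar_locally L) ->
  strictly_increasing_on (open_itv 0 1) f /\
  convex_on (open_itv 0 1) f /\
  has_range (open_itv 0 1) f (open_itv l L).
Proof.
intros Hf Ha HN HaN -> HL; assert (HPI := PI_RGT_0).
assert (Hs : forall r, 0 < r < 1 -> is_series (fun n => PI / 2 * a n * r ^ (2 * n + p)) (f r)).
{ intros r Hr; apply even_power_series; [lra | apply Hf, Hr]. }
assert (Hpos : forall n, 0 <= PI / 2 * a n).
{ intros n; apply Rmult_le_pos; [lra | apply Ha]. }
assert (Hinc : strictly_increasing_on (open_itv 0 1) f).
{ apply (power_series_increasing _ p f N Hs); [intros n _; apply Hpos | exact HN|].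
  apply Rmult_lt_0_compat; lra. }
split; [exact Hinc|split; [exact (power_series_convex _ p f Hs Hpos)|]].
apply increasing_has_range; [exact Hinc | | | exact HL].
- intros r Hr; exact (even_series_continuity _ p f r Hs Hr).
- exact (even_series_at_0 _ p f Hs).
Qed.

Lemma coef_0 : f20coef 0 = 13 / 80 /\ xkcoef 0 = 2 / 3 /\ f22coef 0 = 1 / 15.
Proof.
rewrite f20coef_eq, xkcoef_eq, f22coef_eq.
unfold akcoef, kcoef; simpl; repeat split; field.
Qed.

Lemma f20_properties :
  strictly_increasing_on (open_itv 0 1) f20 /\ convex_on (open_itv 0 1) f20 /\
  has_range (open_itv 0 1) f20 (open_itv 0 (ln 2)).
Proof.
apply (even_series_range f20coef 5 0).
- exact f20_series.
- intros n; apply Rlt_le, f20coef_pos.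
- lia.
- apply f20coef_pos.
- ring.
- exact tends_f20.
Qed.

Lemma f21_properties :
  strictly_increasing_on (open_itv 0 1) f21 /\ convex_on (open_itv 0 1) f21 /\
  has_range (open_itv 0 1) f21 (open_itv 0 p_infty).
Proof.
(* Index 1 supplies strictness because [f21coef 0] is 0. *)
apply (even_series_range f21coef 5 1).
- exact f21_series.
- exact f21coef_nonneg.
- lia.
- apply f21coef_S_pos.
- ring.
- exact f21_infty_at_1.
Qed.

Lemma f22_properties :
  strictly_increasing_on (open_itv 0 1) f22 /\
  has_range (open_itv 0 1) f22 (open_itv (PI / 30) 1).
Proof.
(* Index 1 again, now because for p = 0 the term of index 0 is constant. *)
assert (H := even_series_range f22coef 0 1 f22 (PI / 30) 1 f22_series).
destruct H as [H1 [_ H2]]; [| | | | |split; assumption].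
- intros n; apply Rlt_le, f22coef_pos.
- lia.
- apply f22coef_pos.
- rewrite (proj2 (proj2 coef_0)); field.
- exact tends_f22.
Qed.

Lemma f23_properties :
  strictly_decreasing_on (open_itv 0 1) f23 /\
  has_range (open_itv 0 1) f23 (open_itv 1 (4 * PI / 3)).
Proof.
assert (H := even_series_range f23coef 2 0 (fun r => 4 * PI / 3 - f23 r) 0
  (4 * PI / 3 - 1) f23_series).
destruct H as [H1 [_ H2]].
- intros n; apply Rlt_le, f23coef_pos.
- lia.
- apply f23coef_pos.
- ring.
- apply tends_minus; [apply tends_const | exact tends_f23].
- split.
  + intros x y Hx Hy Hxy; specialize (H1 x y Hx Hy Hxy); simpl in H1; lra.
  + intros y; specialize (H2 (4 * PI / 3 - y)); split.
    * intros [x [Hx Hxy]].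
      destruct (proj1 H2) as [H3 H4]; [exists x; split; [exact Hx | lra]|].
      simpl in H3, H4; split; simpl; lra.
    * intros [H3 H4]; simpl in H3, H4.
      destruct (proj2 H2) as [x [Hx Hxy]]; [split; simpl; lra|].
      exists x; split; [exact Hx | lra].
Qed.

Lemma ratio_denominator_pos (r : R) : 0 < r < 1 ->
  0 < (r - (1 - r ^ 2) * arth r) * ellK r.
Proof.
intros Hr; assert (HPI := PI_RGT_0).
assert (H := is_series_nonneg_ge (fun n => xkcoef n * (r ^ 2) ^ n) _ 0
  (fun n => Rmult_le_pos _ _ (Rlt_le _ _ (xkcoef_pos n)) (pow_le _ n (pow2_ge_0 r)))
  (xk_series r Hr)).
assert (H0 := xkcoef_pos 0); simpl in H.
assert (Hr3 : 0 < r ^ 3) by (apply pow_lt; lra).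
replace ((r - (1 - r ^ 2) * arth r) * ellK r) with
  (PI / 2 * r ^ 3 * (2 / PI * ((r - (1 - r ^ 2) * arth r) * ellK r / r ^ 3)))
  by (field; lra).
apply Rmult_lt_0_compat; [apply Rmult_lt_0_compat; lra | simpl; lra].
Qed.

Lemma f24_f20 (r : R) : 0 < r < 1 ->
  f24 r = 1 - 4 * (f20 r / r ^ 5 / ((r - (1 - r ^ 2) * arth r) * ellK r / r ^ 3)).
Proof.
intros Hr; assert (H := ratio_denominator_pos r Hr).
unfold f24, f20; field.
repeat split; try lra; intros E; rewrite E in H; lra.
Qed.

Lemma f24_increasing : strictly_increasing_on (open_itv 0 1) f24.
Proof.
intros x y [Hx0 Hx1] [Hy0 Hy1] Hxy; simpl in Hx0, Hx1, Hy0, Hy1.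
assert (Hx : 0 < x < 1) by lra; assert (Hy : 0 < y < 1) by lra.
assert (Hxy2 : 0 < x ^ 2 < y ^ 2) by (split; nra).
assert (HPI := PI_RGT_0).
assert (H := power_series_quotient_decreasing f20coef xkcoef (x ^ 2) (y ^ 2) _ _ _ _ Hxy2
  xkcoef_pos f20coef_xkcoef_decreasing
  (f20_series x Hx) (xk_series x Hx) (f20_series y Hy) (xk_series y Hy)).
rewrite (f24_f20 x Hx), (f24_f20 y Hy).
assert (E : forall u v, 0 < v -> 2 / PI * u / (2 / PI * v) = u / v).
{ intros u v Hv; field; lra. }
rewrite !E in H; [lra| |]; apply Rdiv_lt_0_compat;
  try apply ratio_denominator_pos; try apply pow_lt; lra.
Qed.

(** At 0 the quotient of the two series tends to that of their leading coefficients, 13/80 over 2/3,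
    so the limit is 1 - 39/40. At 1, [f20] stays bounded while K is unbounded, and the quotient
    disappears. *)
Lemma f24_range : has_range (open_itv 0 1) f24 (open_itv (1 / 40) 1).
Proof.
assert (HPI := PI_RGT_0).
pose (h := fun r => f20 r / r ^ 5).
pose (g := fun r => (r - (1 - r ^ 2) * arth r) * ellK r / r ^ 3).
assert (Hh : forall r, 0 < r < 1 ->
  is_series (fun n => PI / 2 * f20coef n * r ^ (2 * n + 0)) (h r)).
{ intros r Hr; apply even_power_series; [lra|].
  replace (h r / r ^ 0) with (f20 r / r ^ 5) by (unfold h; field; lra).
  apply f20_series, Hr. }
assert (Hg : forall r, 0 < r < 1 ->
  is_series (fun n => PI / 2 * xkcoef n * r ^ (2 * n + 0)) (g r)).
{ intros r Hr; apply even_power_series; [lra|].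
  replace (g r / r ^ 0) with ((r - (1 - r ^ 2) * arth r) * ellK r / r ^ 3)
    by (unfold g; field; lra).
  apply xk_series, Hr. }
assert (Hg0 : forall r, 0 < r < 1 -> 0 < g r).
{ intros r Hr; apply Rdiv_lt_0_compat; [apply ratio_denominator_pos, Hr | apply pow_lt; lra]. }
apply increasing_has_range.
- exact f24_increasing.
- intros r Hr.
  apply continuity_pt_ext_loc with (f := fun r => 1 - 4 * (h r / g r)).
  + assert (H := filter_and _ _ (open_gt 0 r (proj1 Hr)) (open_lt 1 r (proj2 Hr))).
    apply filter_imp with (2 := H); intros z Hz; symmetry; apply (f24_f20 z Hz).
  + apply continuity_pt_minus; [apply continuity_pt_const; intros ? ?; reflexivity|].
    apply continuity_pt_mult; [apply continuity_pt_const; intros ? ?; reflexivity|].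
    apply continuity_pt_div.
    * exact (even_series_continuity _ 0 h r Hh Hr).
    * exact (even_series_continuity _ 0 g r Hg Hr).
    * apply Rgt_not_eq, Hg0, Hr.
- apply (filterlim_ext_loc (fun r => 1 - 4 * (h r / g r))).
  + exists (mkposreal 1 Rlt_0_1); intros z Hz Hz0.
    apply Rabs_def2 in Hz; unfold minus, plus, opp in Hz; simpl in Hz.
    symmetry; apply f24_f20; lra.
  + destruct coef_0 as [E1 [E2 _]].
    assert (Lh := even_series_at_0 _ 0 h Hh); cbv beta in Lh; rewrite E1 in Lh.
    assert (Lg := even_series_at_0 _ 0 g Hg); cbv beta in Lg; rewrite E2 in Lg.
    assert (Lg' := filterlim_comp _ _ _ g Rinv _ _ _ Lg
      (filterlim_Rbar_inv (Finite (0 ^ 0 * (PI / 2 * (2 / 3))))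
        (fun E => ltac:(injection E; simpl; lra)))).
    assert (Lq := filterlim_comp_2 h (fun r => / g r) Rmult Lh Lg'
      (filterlim_mult (K := R_AbsRing) _ _)).
    replace (1 / 40) with (1 - 4 * (0 ^ 0 * (PI / 2 * (13 / 80)) * / (0 ^ 0 * (PI / 2 * (2 / 3)))))
      by (simpl; field; lra).
    apply (filterlim_comp _ _ _ (fun r => h r * / g r) (fun q => 1 - 4 * q) _ _ _ Lq).
    apply (proj1 (continuity_pt_filterlim (fun q => 1 - 4 * q) _)).
    apply derivable_continuous_pt; reg.
- apply (tends_ext (fun r => 1 - 4 * (f20 r * / r ^ 2
    * / (r - (1 - r ^ 2) * arth r) * / ellK r)) f24 (1 - 4 * (ln 2 * 1 * / 1 * 0)) 1).
  + intros r Hr; rewrite f24_f20 by exact Hr.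
    assert (H := ratio_denominator_pos r Hr).
    field; repeat split; try lra; intros E; rewrite E in H; lra.
  + field.
  + apply tends_minus; [apply tends_const|]; apply tends_mult; [apply tends_const|].
    apply tends_mult; [|exact tends_inv_ellK].
    apply tends_mult; [|apply tends_inv; [lra | exact tends_X]].
    apply tends_mult; [exact tends_f20 | apply tends_pow_inv].
Qed.

(** Sharper than the range of [f20]: dividing by r leaves positive coefficients and the same limit
    at 1. The extra factor r is exactly the one in the denominator of the logarithmic term of
    [P4]. *)
Lemma f20_lt (r : R) : 0 < r < 1 -> f20 r < r * ln 2.
Proof.
intros Hr.
destruct (even_series_range f20coef 4 0 (fun r => f20 r / r) 0 (ln 2)) as [_ [_ H]].
- intros z Hz; replace (f20 z / z / z ^ 4) with (f20 z / z ^ 5) by (field; lra).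
  apply f20_series, Hz.
- intros n; apply Rlt_le, f20coef_pos.
- lia.
- apply f20coef_pos.
- ring.
- apply (tends_ext (fun r => f20 r * / r) _ (ln 2 * / 1)); [reflexivity | field|].
  apply tends_mult; [exact tends_f20 | apply tends_inv; [lra | exact tends_id]].
- assert (T := proj2 (proj1 (H (f20 r / r)) (ex_intro _ r (conj (conj (proj1 Hr) (proj2 Hr)) eq_refl)))).
  simpl in T; apply Rlt_div_l in T; lra.
Qed.

Theorem theorem3p2 :
  ((strictly_increasing_on (open_itv 0 1) f20 /\
    convex_on (open_itv 0 1) f20 /\
    has_range (open_itv 0 1) f20 (open_itv 0 (ln 2))) /\
   (strictly_increasing_on (open_itv 0 1) f21 /\
    convex_on (open_itv 0 1) f21 /\
    has_range (open_itv 0 1) f21 (open_itv 0 p_infty))) /\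
  (strictly_increasing_on (open_itv 0 1) f22 /\
   has_range (open_itv 0 1) f22 (open_itv (PI / 30) 1)) /\
  (strictly_decreasing_on (open_itv 0 1) f23 /\
   has_range (open_itv 0 1) f23 (open_itv 1 (4 * PI / 3))) /\
  (strictly_increasing_on (open_itv 0 1) f24 /\
   has_range (open_itv 0 1) f24 (open_itv (1 / 40) 1) /\
   forall r : R, 0 < r < 1 ->
     3 / 4 + r ^ 2 / 4 * P4 r
       < (ellE r - (1 - r ^ 2) * ellK r) * arth r
         / ((r - (1 - r ^ 2) * arth r) * ellK r) /\
     (ellE r - (1 - r ^ 2) * ellK r) * arth r
         / ((r - (1 - r ^ 2) * arth r) * ellK r)
       < 3 / 4 + r ^ 2 / 4).
Proof.
split; [exact (conj f20_properties f21_properties)|].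
split; [exact f22_properties|].
split; [exact f23_properties|].
split; [exact f24_increasing|].
split; [exact f24_range|].
intros r Hr.
destruct (proj1 (f24_range (f24 r))) as [H1 H2].
{ exists r; split; [split; simpl; lra | reflexivity]. }
simpl in H1, H2; unfold f24 in H1, H2.
assert (Hd := ratio_denominator_pos r Hr).
assert (H3 := f20_lt r Hr); unfold f20 in H3.
unfold P4.
replace (ln 16) with (4 * ln 2).
2: { replace 16 with (2 ^ 4) by ring; rewrite Rpower.ln_pow by lra; simpl; ring. }
replace (r * (r - (1 - r ^ 2) * arth r) * ellK r)
  with (r * ((r - (1 - r ^ 2) * arth r) * ellK r)) by ring.
rewrite Rmult_assoc in H3.
set (XK := (r - (1 - r ^ 2) * arth r) * ellK r) in *.
set (N := (ellE r - (1 - r ^ 2) * ellK r) * arth r) in *.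
clearbody XK N.
assert (HN : N = N / XK * XK) by (field; lra).
set (q := N / XK) in *; clearbody q; subst N.
assert (Hr2 : 0 < r ^ 2) by (apply pow_lt; lra).
assert (E : forall c, 1 / r ^ 2 * c = c / r ^ 2) by (intros c; field; lra).
rewrite E in H1, H2.
apply Rlt_div_l in H2; [|exact Hr2]; apply Rlt_div_r in H1; [|exact Hr2].
split; [|lra].
(* The value 1/40 is settled by the range of [f24]; the logarithmic one remains and follows from
   [f20_lt]. *)
unfold Rmax; destruct Rle_dec as [_|_]; [|lra].
apply Rmult_lt_reg_r with XK; [exact Hd|].
replace ((3 / 4 + r ^ 2 / 4 * (1 - 4 * ln 2 / (r * XK))) * XK)
  with ((3 / 4 + r ^ 2 / 4) * XK - r * ln 2) by (field; lra).
lra.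
Qed.
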